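(* Let $q(t)$ be a solution of the Painlevé II equation $q''=2q^3+tq$, let $u=(q')^2-tq^2-q^4$ (so $u'=-q^2$), and consider the linear system of ODEs for $(\mu_+,\mu_-,\nu)$: $$3q^2\mu_+'=(q^2)'\mu_+-q^2\nu,\qquad 3q^2\mu_-'=-(q^2)'\mu_-+q^2\nu,\qquad 3q^2\nu'=2q^4\mu_--2u\mu_+.$$ Let $t_0\in\mathbb C$ be any pole of $q$. Then near $t_0$ there are three types of series solutions of this system: 1) solutions with exponents $m_+=m_-=4/3$, $m_\nu=1/3$ and one free constant; 2) solutions with exponents $m_+=m_-=1/3$, $m_\nu=-2/3$ and two free constants; 3) solutions with exponents $m_+=m_\nu=-2/3$, $m_-=1/3$ and three free constants. The third type is thus generic (it contains as many free constants as the order of the system).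
   Context: Put $z=t-t_0$ and fix a branch of $z^{1/3}$ near $z=0$. A series solution ''with exponents $m_+,m_-,m_\nu$'' is a local solution of the form $$\mu_+=z^{m_+}\sum_{n\ge0}K_nz^n,\qquad \mu_-=z^{m_-}\sum_{n\ge0}M_nz^n,\qquad \nu=z^{m_\nu}\sum_{n\ge0}S_nz^n$$ (no logarithmic terms). Saying that a type has ''$N$ free constants'' means that the solutions of this form (with leading coefficients allowed to vanish) make up an $N$-dimensional complex vector space: $N$ of the coefficients can be chosen arbitrarily and all other coefficients are then determined recursively; for generic choices of the free constants the leading coefficients $K_0,M_0,S_0$ are all nonzero, so that the exponents are the actual leading exponents. All solutions of $q''=2q^3+tq$ are meromorphic in $\mathbb C$ and all their poles are simple. *)

(* Defs.v *)
(* C is meant to be R[i] for a realType R; over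
   an abstract numClosedFieldType the library infers the topology of C.  In such
   a field 0 <= x means that x is a nonnegative real, so real radii and real
   scalars are elements of C. *)
From HB Require Import structures.
From mathcomp Require Import all_boot all_order all_algebra.
From mathcomp Require Import all_classical all_reals all_analysis.
Import Order.TTheory GRing.Theory Num.Theory.
Import numFieldNormedType.Exports.

Set Implicit Arguments.
Unset Strict Implicit.
Unset Printing Implicit Defensive.

Local Open Scope classical_set_scope.
Local Open Scope ring_scope.

Section Defs.
Variable C : numClosedFieldType.

(* [pseries] of the library is restricted to real coefficients. *)
Definition power_series (c : nat -> C) (z : C) : nat -> C :=
  series (fun n => c n * z ^+ n).

Definition analytic_at (f : C -> C) (a : C) : Prop :=
  exists c : nat -> C,
    \forall t \near a, power_series c (t - a) @ \oo --> f t.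

(* The value f a at a pole a is irrelevant: a^' is the punctured
   neighbourhood filter. *)
Definition is_pole (f : C -> C) (a : C) : Prop :=
  exists (k : nat) (g : C -> C),
    [/\ (0 < k)%N, analytic_at g a, g a != 0 &
        \forall t \near a^', f t = g t / (t - a) ^+ k].

Definition meromorphic (f : C -> C) : Prop :=
  forall a, analytic_at f a \/ is_pole f a.

Definition painleve2_solution (q : C -> C) : Prop :=
  meromorphic q /\
  forall t, analytic_at q t -> derive1n 2 q t = 2 * q t ^+ 3 + t * q t.

Definition painleve2_u (q : C -> C) (t : C) : C :=
  derive1 q t ^+ 2 - t * q t ^+ 2 - q t ^+ 4.

Inductive unknown := MuPlus | MuMinus | Nu.

Definition solves_system_on (D : set C) (q : C -> C) (y : unknown -> C -> C) :
    Prop :=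
  let q2 := fun s => q s ^+ 2 in
  forall t, D t ->
  [/\ forall x, derivable (y x) t 1,
      3 * q2 t * derive1 (y MuPlus) t =
        derive1 q2 t * y MuPlus t - q2 t * y Nu t,
      3 * q2 t * derive1 (y MuMinus) t =
        - derive1 q2 t * y MuMinus t + q2 t * y Nu t &
      3 * q2 t * derive1 (y Nu) t =
        2 * q t ^+ 4 * y MuMinus t - 2 * painleve2_u q t * y MuPlus t].

(* The disc |z| < e cut along the closed ray from 0 through w; 0 itself lies on
   the cut. *)
Definition slit_disc (w e : C) : set C :=
  [set z | `|z| < e /\ forall x : C, 0 <= x -> z != x * w].

Definition cbrt_branch (w rho : C) (r : C -> C) : Prop :=
  forall z, slit_disc w rho z -> {for z, continuous r} /\ r z ^+ 3 = z.

(* z^m := (z^(1/3))^(3m) for the branch r of z^(1/3); only meaningful when 3m is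
   an integer, which is then numq (3 * m). *)
Definition branch_pow (r : C -> C) (m : rat) (z : C) : C :=
  r z ^ numq (3 * m).

Definition exponents (mplus mminus mnu : rat) (x : unknown) : rat :=
  match x with MuPlus => mplus | MuMinus => mminus | Nu => mnu end.

(* a MuPlus, a MuMinus, a Nu are the sequences K, M, S. *)
Definition coefficients := unknown -> nat -> C.

Definition has_expansion (t0 w e : C) (r : C -> C) (m : unknown -> rat)
    (a : coefficients) (y : unknown -> C -> C) : Prop :=
  forall x z, slit_disc w e z ->
    exists2 s : C, power_series (a x) z @ \oo --> s &
                   y x (t0 + z) = branch_pow r (m x) z * s.

(* Coefficient families of the local solutions with exponents m; the leading
   coefficients a x 0 are allowed to vanish. *)
Definition series_solutions (q : C -> C) (t0 w rho : C) (r : C -> C)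
    (m : unknown -> rat) : set coefficients :=
  [set a | exists (e : C) (y : unknown -> C -> C),
     [/\ 0 < e <= rho, has_expansion t0 w e r m a y &
         solves_system_on [set t0 + z | z in slit_disc w e] q y]].

Definition lincomb (N : nat) (c : 'I_N -> C) (b : 'I_N -> coefficients) :
    coefficients :=
  fun x n => \sum_(i < N) c i * b i x n.

Definition is_vspace_of_dim (N : nat) (V : set coefficients) : Prop :=
  exists b : 'I_N -> coefficients,
    (forall c, (forall x n, lincomb c b x n = 0) -> forall i, c i = 0) /\
    V = [set lincomb c b | c in [set: 'I_N -> C]].

Section FreeConstants.
Variables (N : nat) (V : set coefficients) (p : 'I_N -> unknown * nat).

Definition constant_at (a : coefficients) (i : 'I_N) : C := a (p i).1 (p i).2.

Definition freely_parametrized : Prop :=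
  forall c : 'I_N -> C, exists! a, V a /\ forall i, constant_at a i = c i.

(* The coefficients of index at most n only depend on the free constants of
   index at most n. *)
Definition recursively_determined : Prop :=
  forall (n : nat) a a', V a -> V a' ->
    (forall i, ((p i).2 <= n)%N -> constant_at a i = constant_at a' i) ->
    forall x k, (k <= n)%N -> a x k = a' x k.

(* Generic: outside a finite union of hyperplanes of C^N. *)
Definition generically_nonzero_leading : Prop :=
  exists (k : nat) (l : 'I_k -> 'I_N -> C),
    (forall j, exists i, l j i != 0) /\
    forall a, V a ->
      (forall j, \sum_(i < N) l j i * constant_at a i != 0) ->
      forall x, a x 0%N != 0.

End FreeConstants.

Definition has_free_constants (N : nat) (V : set coefficients) : Prop :=
  is_vspace_of_dim N V /\
  exists p : 'I_N -> unknown * nat,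
    [/\ freely_parametrized V p, recursively_determined V p &
        generically_nonzero_leading V p].

(* Every local solution on a slit neighbourhood of t0 is, close enough to t0, a
   series solution with exponents m. *)
Definition generic_type (q : C -> C) (t0 w rho : C) (r : C -> C)
    (m : unknown -> rat) : Prop :=
  forall (e : C) (y : unknown -> C -> C), 0 < e <= rho ->
    solves_system_on [set t0 + z | z in slit_disc w e] q y ->
    exists (a : coefficients) (e' : C),
      0 < e' <= e /\ has_expansion t0 w e' r m a y.

End Defs.

(* Main.v *)
(* With z = t - t0 the equation for q forces a simple pole,
   q = +-(1/z - t0 z/6 + ...), so that al = 1 + z q'/q, be = z^2 q^2 and
   de = z^2 u/q^2 are power series with al = O(z^2), be = 1 + O(z^2) and
   de = O(z^3).  In the unknowns mu_+, mu_-, z nu the system becomes Fuchsian with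
   exponents -2/3, 1/3, 4/3; the vanishing of these low coefficients is exactly
   what cancels the logarithms at the two resonances, and a geometric majorant
   gives convergence.  The system is traceless, so the determinant of three
   solutions is constant on the slit disc, and Cramer's rule expresses every
   solution through the three Frobenius series.  The three types are then the
   subspaces of this solution space on which the first few coefficients
   vanish. *)

(* The cube root has no single-valued branch around the pole, hence the slit disc. It is star-shaped
   about the points opposite the slit, so the mean value theorem on segments replaces complex
   integration when a function with zero derivative has to be constant. The exponents differ by
   integers, so one normalisation by z^(-2/3) serves all of them, and prescribing higher exponents
   amounts to shifting coefficient sequences. A series solution is only assumed to converge
   pointwise on a slit disc of its own radius; convergence at one point other than 0 already bounds
   its coefficients geometrically, so the series has a sum on a full disc and its coefficients can
   be identified from values on the ray opposite the slit. This leads from Cramer's rule, a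
   statement on functions, to an equality of coefficient sequences. In the generic type nu has
   exponent -2/3 and not -5/3 because the equations at order 0 force the constant terms of the
   series for mu_- and z nu to vanish. *)
Require Import Defs.
From mathcomp Require Import all_boot all_order all_algebra complex.
From mathcomp Require Import all_classical all_reals all_analysis.
From mathcomp Require Import ring lra zify.
Import Order.TTheory GRing.Theory Num.Theory.
Import numFieldNormedType.Exports.

Set Implicit Arguments.
Unset Strict Implicit.
Unset Printing Implicit Defensive.

Local Open Scope classical_set_scope.
Local Open Scope complex_scope.
Local Open Scope ring_scope.

(* R[i] packed as a numClosedFieldType: on the bare type R[i] the library does
   not infer a topology. *)
Definition Cx (R : realType) : numClosedFieldType := R[i].

(** * Complex modulus and limits *)

Section Modulus.
Variable R : realType.
Local Notation C := (Cx R).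
Implicit Types (x y z : C) (e : R).

(** The norm of [C] takes its values in [C], which is only partially ordered; a modulus in [R] gives
    access to the total order and to [lra] and [nra]. *)
Definition nm (z : C) : R := complex.ComplexField.Normc.normc z.
Definition inC (x : R) : C := x%:C.

Lemma normE z : `|z| = inC (nm z).
Proof. by case: z => a b; rewrite normc_def. Qed.

Lemma inC_lt (a b : R) : (inC a < inC b) = (a < b).
Proof. exact: ltcR. Qed.

Lemma inC_le (a b : R) : (inC a <= inC b) = (a <= b).
Proof. exact: lecR. Qed.

Lemma inC_inj : injective inC.
Proof. by move=> a b; apply: complexI. Qed.

Lemma inCD (a b : R) : inC (a + b) = inC a + inC b.
Proof. exact: (rmorphD (real_complex R)). Qed.
Lemma inCM (a b : R) : inC (a * b) = inC a * inC b.
Proof. exact: (rmorphM (real_complex R)). Qed.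
Lemma inC0 : inC 0 = 0.
Proof. exact: (rmorph0 (real_complex R)). Qed.
Lemma inC1 : inC 1 = 1.
Proof. exact: (rmorph1 (real_complex R)). Qed.

Lemma nm_inj x y : `|x| = `|y| -> nm x = nm y.
Proof. by rewrite !normE => /inC_inj. Qed.

Lemma nmM x y : nm (x * y) = nm x * nm y.
Proof. by apply: inC_inj; rewrite inCM -!normE normrM. Qed.

Lemma nm0 : nm 0 = 0.
Proof. by apply: inC_inj; rewrite -!normE normr0 inC0. Qed.

Lemma nm1 : nm 1 = 1.
Proof. by apply: inC_inj; rewrite -!normE normr1 inC1. Qed.

Lemma nm_ge0 z : 0 <= nm z.
Proof. by rewrite -inC_le -normE inC0 normr_ge0. Qed.

Lemma nmD x y : nm (x + y) <= nm x + nm y.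
Proof. by rewrite -inC_le inCD -!normE ler_normD. Qed.

Lemma nmN x : nm (- x) = nm x.
Proof. by apply: nm_inj; rewrite normrN. Qed.

Lemma nmB x y : nm (x - y) <= nm x + nm y.
Proof. by rewrite -(nmN y) nmD. Qed.

Lemma nm_distC x y : nm (x - y) = nm (y - x).
Proof. by rewrite -nmN opprB. Qed.

Lemma nm_eq0 x : (nm x == 0) = (x == 0).
Proof.
rewrite -(normr_eq0 x) normE -[0 : C]inC0.
by apply/eqP/eqP => [->|/inC_inj].
Qed.

Lemma nm_gt0 x : (0 < nm x) = (x != 0).
Proof. by rewrite lt_def nm_eq0 nm_ge0 andbT. Qed.

Lemma nmX x n : nm (x ^+ n) = nm x ^+ n.
Proof. by elim: n => [|n IH]; rewrite ?expr0 ?nm1 // !exprS nmM IH. Qed.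

Lemma nmV x : nm x^-1 = (nm x)^-1.
Proof.
have [->|x0] := eqVneq x 0; first by rewrite invr0 nm0 invr0.
have nx0 : nm x != 0 by rewrite nm_eq0.
by apply: (mulfI nx0); rewrite -nmM !divff// nm1.
Qed.

Lemma nm_inC (a : R) : nm (inC a) = `|a|.
Proof.
have H (b : R) : 0 <= b -> nm (inC b) = b.
  by move=> b0; apply: inC_inj; rewrite -normE ger0_norm// -inC0 inC_le.
have [a0|a0] := leP 0 a; first by rewrite ger0_norm// H.
rewrite ltr0_norm// -nmN (_ : - inC a = inC (- a)) ?H ?oppr_ge0 1?ltW//.
exact/esym/(rmorphN (real_complex R)).
Qed.

Lemma nm_nat n : nm n%:R = n%:R.
Proof. 
have <- : inC n%:R = n%:R := rmorph_nat (real_complex R) n.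
by rewrite nm_inC normr_nat.
Qed.

Lemma nm_sum (I : Type) (r : seq I) (P : pred I) (F : I -> C) :
  nm (\sum_(i <- r | P i) F i) <= \sum_(i <- r | P i) nm (F i).
Proof.
elim/big_ind2: _ => //; first by rewrite nm0.
by move=> x a y b xa yb; apply: le_trans (nmD _ _) (lerD xa yb).
Qed.

Lemma gt0_inC (e : C) : 0 < e -> exists2 d : R, 0 < d & e = inC d.
Proof.
move=> e0; exists (nm e); first by rewrite nm_gt0 gt_eqF.
by rewrite -normE gtr0_norm.
Qed.

Lemma norm_lt z e : (`|z| < inC e) = (nm z < e).
Proof. by rewrite normE inC_lt. Qed.

Lemma nearP (a : C) (P : C -> Prop) :
  (\forall t \near a, P t) <-> exists2 e : R, 0 < e & forall t, nm (t - a) < e -> P t.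
Proof.
split=> [/nbhs_ballP[e /= /gt0_inC[d d0 ->] H]|[e e0 H]].
  by exists d => // t ht; apply: H; rewrite -ball_normE /= -opprB normrN norm_lt.
apply/nbhs_ballP; exists (inC e); first by rewrite /= -inC0 inC_lt.
by move=> t; rewrite -ball_normE /= -opprB normrN norm_lt; apply: H.
Qed.

Lemma near_punctP (a : C) (P : C -> Prop) :
  (\forall t \near a^', P t) <->
  exists2 e : R, 0 < e & forall t, t != a -> nm (t - a) < e -> P t.
Proof.
rewrite near_withinE; split=> [/nearP[e e0 H]|[e e0 H]].
  by exists e => // t ta te; apply: H.
by apply/nearP; exists e => // t te ta; apply: H.
Qed.

Lemma cvg_seqP (u : nat -> C) (l : C) :
  u @ \oo --> l <->
  forall e : R, 0 < e -> exists N, forall n, (N <= n)%N -> nm (u n - l) < e.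
Proof.
split=> [/cvgrPdist_lt H e e0|H].
  have [|N _ HN] := H (inC e); first by rewrite -inC0 inC_lt.
  by exists N => n nN; rewrite nm_distC -norm_lt HN.
apply/cvgrPdist_lt => _ /gt0_inC[e e0 ->]; have [N HN] := H e e0.
by exists N => // n /= nN; rewrite norm_lt nm_distC HN.
Qed.

Lemma continuousP (f : C -> C) (a : C) : {for a, continuous f} <->
  forall e : R, 0 < e -> exists2 d : R, 0 < d &
    forall h, nm h < d -> nm (f (a + h) - f a) < e.
Proof.
split=> [/cvgrPdist_lt H e e0|H].
  have [|d d0 Hd] := (nearP _ _).1 (H (inC e) _); first by rewrite -inC0 inC_lt.
  exists d => // h hd; rewrite nm_distC -norm_lt Hd//.
  by rewrite [a + h]addrC addrK.
apply/(@cvgrPdist_lt _ _ _ (nbhs a) (nbhs_filter a)) => _ /gt0_inC[e e0 ->]; have [d d0 Hd] := H e e0.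
apply/nearP; exists d => // t /Hd; rewrite addrCA subrr addr0.
by rewrite norm_lt nm_distC.
Qed.

(** Clearing the denominator of the difference quotient leaves an inequality that also holds at
    [h = 0], so estimates can be composed without excluding that point. *)
Lemma is_deriveP (f : C -> C) (a df : C) : is_derive a 1 f df <->
  forall e : R, 0 < e -> exists2 d : R, 0 < d &
    forall h, nm h < d -> nm (f (a + h) - f a - h * df) <= e * nm h.
Proof.
have E (l h : C) : h != 0 ->
    nm (l - h^-1 *: (f (h *: 1 + a) - f a)) * nm h =
    nm (f (a + h) - f a - h * l).
  move=> h0; rewrite -nmM nm_distC; congr nm.
  rewrite /GRing.scale /= mulr1 [h + a]addrC mulrBl mulrAC mulVf// mul1r.
  by rewrite [h * _]mulrC.
split=> [[+ <-] e e0|H].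
  rewrite /derivable -/('D_1 f a) => /cvgrPdist_lt /(_ (inC e)).
  rewrite -{1}inC0 inC_lt => /(_ e0) /near_punctP[d d0 Hd].
  exists d => // h hd; have [->|h0] := eqVneq h 0.
    by rewrite addr0 mul0r !subrr nm0 mulr0.
  move: (Hd h h0); rewrite subr0 => /(_ hd); rewrite norm_lt => H.
  by rewrite -E// ler_pM2r ?nm_gt0// ltW.
suff K : h^-1 *: ((f \o shift a) (h *: 1) - f a) @[h --> 0^'] --> df.
  split; first by apply/cvg_ex; exists df.
  exact: cvg_lim K.
apply/cvgrPdist_lt => _ /gt0_inC[e e0 ->].
have [d d0 Hd] := H (e / 2) (divr_gt0 e0 (ltr0Sn _ 1)).
apply/near_punctP; exists d => // h h0; rewrite subr0 norm_lt => /Hd.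
rewrite -E// ler_pM2r ?nm_gt0// => /le_lt_trans; apply.
by lra.
Qed.

End Modulus.

(** * Convergent power series *)

Section Expansions.
Variable R : realType.
Local Notation C := (Cx R).
Implicit Types (f g : C -> C) (c d : nat -> C) (z : C) (M T e : R).

Definition psum c z N : C := \sum_(n < N) c n * z ^+ n.

Definition geo c := exists M T, [/\ 0 <= M, 0 < T & forall n, nm (c n) <= M * T ^+ n].

(* Convergence to f near 0 stated as a geometric error bound for all partial
   sums, a form that is stable under products without rearranging series. *)
Definition expands f c M T := forall N z,
  T * nm z <= 1 -> nm (f z - psum c z N) <= M * (T * nm z) ^+ N.

(** [c] is the Taylor series of [f] at 0. The radius stays existential, so every operation may
    shrink it. *)
Definition hs f c := exists M T, [/\ 0 <= M, 0 < T & expands f c M T].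

Definition near0 (P : C -> Prop) := exists2 e : R, 0 < e & forall z, nm z < e -> P z.

Lemma near0_and (P Q : C -> Prop) : near0 P -> near0 Q -> near0 (fun z => P z /\ Q z).
Proof.
move=> [e e0 He] [d d0 Hd]; exists (Num.min e d); first by rewrite lt_min e0.
by move=> z; rewrite lt_min => /andP[ze zd]; split; [apply: He|apply: Hd].
Qed.

Lemma near0_sub (P Q : C -> Prop) : (forall z, P z -> Q z) -> near0 P -> near0 Q.
Proof. by move=> PQ [e e0 H]; exists e => // z /H /PQ. Qed.

Lemma geometric_lt M (x e : R) : 0 <= x < 1 -> 0 < e ->
  exists N, forall n, (N <= n)%N -> M * x ^+ n < e.
Proof.
move=> /andP[x0 x1] e0.
have := @cvg_geometric R M x; rewrite ger0_norm// => /(_ x1) /cvgrPdist_lt /(_ _ e0)[N _ H].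
exists N => n nN; have := H n nN; rewrite sub0r normrN /geometric /=.
exact/le_lt_trans/ler_norm.
Qed.

Lemma power_seriesE c z N : power_series c z N = psum c z N.
Proof. by rewrite /power_series /series /= big_mkord. Qed.

Lemma psumS c z N : psum c z N.+1 = psum c z N + c N * z ^+ N.
Proof. by rewrite /psum big_ord_recr. Qed.

Lemma expandsW f c M M' T T' : 0 <= M -> M <= M' -> 0 <= T -> T <= T' ->
  expands f c M T -> expands f c M' T'.
Proof.
move=> M0 MM T0 TT H N z Tz.
have zz : T * nm z <= T' * nm z by rewrite ler_wpM2r// nm_ge0.
apply: le_trans (H N z (le_trans zz Tz)) _.
apply: ler_pM => //; first by rewrite exprn_ge0// mulr_ge0// nm_ge0.
by rewrite lerXn2r// nnegrE mulr_ge0// ?nm_ge0// (le_trans T0).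
Qed.

Lemma hs2 f c g d : hs f c -> hs g d ->
  exists M T, [/\ 0 < M, 0 < T, expands f c M T & expands g d M T].
Proof.
move=> [M [T [M0 T0 Hf]]] [M' [T' [M'0 T'0 Hg]]].
exists (M + M' + 1), (T + T'); split; try lra.
- by apply: expandsW Hf; lra.
- by apply: expandsW Hg; lra.
Qed.

(** At a point with [T * nm z = 1] two consecutive partial sums differ by [c n * z ^+ n], and both
    are within M of [f z]. *)
Lemma expands_coef f c M T : 0 < T -> expands f c M T ->
  forall n, nm (c n) <= 2 * M * T ^+ n.
Proof.
move=> T0 H n; pose z : C := inC T^-1.
have zE : nm z = T^-1 by rewrite /z nm_inC ger0_norm// invr_ge0 ltW.
have Tz : T * nm z = 1 by rewrite zE divff// gt_eqF.
have Tz1 : T * nm z <= 1 by rewrite Tz.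
have := nmB (f z - psum c z n) (f z - psum c z n.+1).
rewrite (_ : _ - _ = c n * z ^+ n); last by rewrite psumS; ring.
rewrite nmM nmX zE => /le_trans.
move=> /(_ _ (lerD (H n z Tz1) (H n.+1 z Tz1))).
by rewrite Tz !expr1n !mulr1 -mulr2n -[M *+ 2]mulr_natl exprVn ler_pdivrMr ?exprn_gt0.
Qed.

Lemma hs_geo f c : hs f c -> geo c.
Proof.
move=> [M [T [M0 T0 H]]]; exists (2 * M), T; split=> //; first lra.
exact: expands_coef H.
Qed.

Lemma expands_cvg f c M T z : 0 < T -> expands f c M T -> T * nm z < 1 ->
  power_series c z @ \oo --> f z.
Proof.
move=> T0 H Tz; apply/cvg_seqP => e e0.
have [|N HN] := @geometric_lt M (T * nm z) e _ e0.
  by rewrite Tz mulr_ge0 ?nm_ge0// ltW.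
exists N => n /HN; apply: le_lt_trans.
by rewrite power_seriesE nm_distC H// ltW.
Qed.

Lemma hs_cvg f c : hs f c -> near0 (fun z => power_series c z @ \oo --> f z).
Proof.
move=> [M [T [M0 T0 H]]]; exists T^-1; first by rewrite invr_gt0.
move=> z zT; apply: (expands_cvg T0 H).
by rewrite -(@ltr_pM2l _ T^-1) ?invr_gt0// mulKf ?mulr1// gt_eqF.
Qed.

Lemma cvg_unique_seq (u : nat -> C) (a b : C) : u @ \oo --> a -> u @ \oo --> b -> a = b.
Proof. by apply: cvg_unique; exact: norm_hausdorff. Qed.

Lemma cvg_nm_le (u : nat -> C) (l a : C) (B : R) N :
  u @ \oo --> l -> (forall n, (N <= n)%N -> nm (u n - a) <= B) -> nm (l - a) <= B.
Proof.
move=> /cvg_seqP ul H; apply/ler_addgt0Pr => e e0; have [N' HN'] := ul e e0.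
pose n := maxn N N'.
have := nmD (l - u n) (u n - a); rewrite addrA subrK => /le_trans; apply.
rewrite addrC lerD ?H ?leq_maxl// nm_distC ltW// HN'// leq_maxr.
by [].
Qed.

Lemma geo_sum_le (x : R) k : 0 <= x -> x <= 2^-1 -> \sum_(j < k) x ^+ j <= 2.
Proof.
move=> x0 x2; have x1 : 0 < 1 - x by lra.
rewrite -(ler_pM2l x1) (_ : (1 - x) * _ = 1 - x ^+ k); last first.
  by rewrite -[RHS]opprB subrX1 -mulNr opprB.
by have := exprn_ge0 k x0; lra.
Qed.

Lemma psum_tail c z M T N n : 0 <= M -> 0 < T -> (forall n, nm (c n) <= M * T ^+ n) ->
  T * nm z <= 2^-1 -> (N <= n)%N ->
  nm (psum c z n - psum c z N) <= 2 * M * (T * nm z) ^+ N.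
Proof.
move=> M0 T0 H Tz Nn.
have x0 : 0 <= T * nm z by rewrite mulr_ge0 ?nm_ge0// ltW.
have -> : psum c z n - psum c z N = \sum_(j < n - N) c (N + j)%N * z ^+ (N + j).
  rewrite -{1}(subnKC Nn) /psum big_split_ord /=.
  by rewrite [X in X + _ - _](_ : _ = psum c z N) // addrC addKr.
apply: le_trans (nm_sum _ _ _) _.
have : \sum_(j < n - N) M * (T * nm z) ^+ N * (T * nm z) ^+ j <= 2 * M * (T * nm z) ^+ N.
  rewrite -mulr_sumr mulrC -[leRHS]mulrA ler_wpM2r ?geo_sum_le//.
  by rewrite mulr_ge0// exprn_ge0.
apply: le_trans; apply: ler_sum => j _.
rewrite nmM nmX -mulrA -exprD exprMn mulrA ler_wpM2r// exprn_ge0// nm_ge0.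
by [].
Qed.

Lemma hs_of_cvg c f : geo c -> near0 (fun z => power_series c z @ \oo --> f z) -> hs f c.
Proof.
move=> [M [T [M0 T0 H]]] [e e0 He].
(* The term [2 * T] keeps [T * nm z] below 1/2, so that a geometric tail is at most twice its first
   term; [2 / e] keeps z inside the disc of convergence. *)
exists (2 * M), (2 * T + 2 / e); have e20 : 0 < 2 / e by rewrite divr_gt0.
split; try lra.
move=> N z; rewrite mulrDl => Tz.
have ez : 0 <= 2 / e * nm z by rewrite mulr_ge0 ?nm_ge0// ltW.
have Tz0 : 0 <= T * nm z by rewrite mulr_ge0 ?nm_ge0// ltW.
have ze : nm z < e.
  have : 2 / e * nm z <= 1 by lra.
  by rewrite mulrAC ler_pdivrMr// mul1r; have := nm_ge0 z; lra.
apply: (@le_trans _ _ (2 * M * (T * nm z) ^+ N)).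
  apply: (cvg_nm_le (N := N) (He z ze)) => n Nn.
  by rewrite power_seriesE; apply: psum_tail => //; lra.
rewrite ler_wpM2l//; first lra.
by rewrite lerXn2r// ?nnegrE; lra.
Qed.

Lemma ReIm_le (w : C) : `|complex.Re w| <= nm w /\ `|complex.Im w| <= nm w.
Proof.
case: w => a b; rewrite /nm /= -!sqrtr_sqr.
by split; rewrite ler_wsqrtr// ?lerDl ?lerDr ?sqr_ge0.
Qed.

Lemma real_series_cvg (a : nat -> R) M (x : R) : 0 <= x < 1 -> 0 <= M ->
  (forall n, `|a n| <= M * x ^+ n) -> cvgn (series a).
Proof.
move=> /andP[x0 x1] M0 H; apply: normed_cvg.
apply: (series_le_cvg (v_ := geometric M x)) => //.
- by move=> n; rewrite /= normr_ge0.
- by move=> n; rewrite /geometric /= mulr_ge0// exprn_ge0.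
- by apply: is_cvg_geometric_series; rewrite ger0_norm.
Qed.

(** Real and imaginary parts are dominated by the modulus, so absolute convergence over [R] applies
    to each. *)
Lemma complex_series_cvg (a : nat -> C) M (x : R) : 0 <= x < 1 -> 0 <= M ->
  (forall n, nm (a n) <= M * x ^+ n) -> exists l : C, series a @ \oo --> l.
Proof.
move=> x01 M0 H.
have Hr : cvgn (series (fun n => complex.Re (a n))).
  by apply: (real_series_cvg x01 M0) => n; apply: le_trans (H n); case: (ReIm_le (a n)).
have Hi : cvgn (series (fun n => complex.Im (a n))).
  by apply: (real_series_cvg x01 M0) => n; apply: le_trans (H n); case: (ReIm_le (a n)).
move: Hr Hi => /cvg_ex[lr /= Hr] /cvg_ex[li /= Hi].
exists (Complex lr li); apply/cvg_seqP => e e0.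
have e2 : 0 < e / 2 by rewrite divr_gt0.
move: Hr Hi => /cvgrPdist_lt /(_ _ e2)[N1 _ H1] /cvgrPdist_lt /(_ _ e2)[N2 _ H2].
exists (maxn N1 N2) => n; rewrite geq_max => /andP[/H1 h1 /H2 h2].
have E : series a n = Complex (series (fun n => complex.Re (a n)) n)
                              (series (fun n => complex.Im (a n)) n).
  rewrite /series /=; elim: n {h1 h2} => [|n IH]; first by rewrite !big_nil.
  by rewrite !big_nat_recr//= IH; case: (a n).
have nmle (p q : R) : nm (Complex p q : C) <= `|p| + `|q|.
  rewrite /nm /= -(@ger0_norm _ (`|p| + `|q|)) ?addr_ge0// -sqrtr_sqr ler_wsqrtr//.
  rewrite sqrrD !real_normK ?num_real//.
  by have := mulr_ge0 (normr_ge0 p) (normr_ge0 q); lra.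
rewrite E; apply: le_lt_trans (nmle _ _) _.
by move: h1 h2; rewrite /= distrC [X in _ -> X < _ -> _]distrC => h1 h2; lra.
Qed.

Lemma geo_hs c : geo c -> exists f, hs f c.
Proof.
move=> gc; have [M [T [M0 T0 H]]] := gc.
(* The sum is chosen point by point; outside the disc the value 0 is a mere default. *)
have K z : exists l : C, nm z < (2 * T)^-1 -> power_series c z @ \oo --> l.
  have [zT|zT] := ltP (nm z) (2 * T)^-1; last by exists 0.
  have Tz : 0 <= T * nm z < 1.
    rewrite mulr_ge0 ?nm_ge0 1?ltW//=; move: zT.
    by rewrite -(ltr_pM2l T0) invfM mulrCA divff ?gt_eqF// mulr1; lra.
  have [|l Hl] := @complex_series_cvg (fun n => c n * z ^+ n) M _ Tz M0.
    by move=> n; rewrite nmM nmX exprMn mulrA ler_wpM2r// exprn_ge0// nm_ge0.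
  by exists l.
have [f Hf] := choice K; exists f; apply: hs_of_cvg => //.
by exists (2 * T)^-1 => //; rewrite invr_gt0; lra.
Qed.

Lemma hs_ext f g c : near0 (fun z => f z = g z) -> hs f c -> hs g c.
Proof.
move=> Hfg Hf; apply: hs_of_cvg (hs_geo Hf) _.
by apply: near0_sub (near0_and Hfg (hs_cvg Hf)) => z [->].
Qed.

Lemma hs_uniq f g c : hs f c -> hs g c -> near0 (fun z => f z = g z).
Proof.
move=> /hs_cvg Hf /hs_cvg Hg; apply: near0_sub (near0_and Hf Hg) => z [].
exact: cvg_unique_seq.
Qed.

Lemma hs0 f c : hs f c -> f 0 = c 0%N.
Proof.
move=> [M [T [M0 T0 H]]]; have := H 1%N 0; rewrite nm0 mulr0 ler01 => /(_ isT).
rewrite expr1 mulr0 /psum big_ord1 expr0 mulr1 => h.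
by apply/eqP; rewrite -subr_eq0 -nm_eq0 eq_le h nm_ge0.
Qed.

End Expansions.

(** * Products, identity theorem and derivatives of power series *)

Lemma cvg_subM (K : numFieldType) (a b d : nat -> K) (la lb ld h : K) :
  a @ \oo --> la -> b @ \oo --> lb -> d @ \oo --> ld ->
  (fun n => a n - b n - h * d n) @ \oo --> la - lb - h * ld.
Proof. by move=> *; apply: cvgB; [exact: cvgB|apply: cvgM => //; exact: cvg_cst]. Qed.

Section Operations.
Variable R : realType.
Local Notation C := (Cx R).
Implicit Types (f g : C -> C) (c d : nat -> C) (z : C) (M T e : R).

Definition conv c d n : C := \sum_(i < n.+1) c i * d (n - i)%N.

Lemma natr_le_expr2 n : n%:R <= (2 : R) ^+ n.
Proof. by rewrite -natrX ler_nat ltnW// ltn_expl. Qed.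

(** Grouping by the index of [c] exhibits truncated sums of [d], whose errors are controlled by
    [expands]; a product of two partial sums would leave extra terms. *)
Lemma psum_conv c d z N :
  psum (conv c d) z N = \sum_(i < N) c i * z ^+ i * psum d z (N - i).
Proof.
elim: N => [|N IH]; first by rewrite /psum !big_ord0.
rewrite psumS IH.
have -> : \sum_(i < N.+1) c i * z ^+ i * psum d z (N.+1 - i) =
  \sum_(i < N.+1) (c i * z ^+ i * psum d z (N - i) + c i * d (N - i)%N * z ^+ N).
  apply: eq_bigr => i _; rewrite subSn ?psumS; last by rewrite -ltnS.
  rewrite mulrDr; congr (_ + _).
  have iN : (i <= N)%N by rewrite -ltnS.
  have -> : z ^+ N = z ^+ i * z ^+ (N - i) by rewrite -exprD subnKC.
  by ring.
rewrite big_split /= -mulr_suml big_ord_recr /= subnn.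
by rewrite [psum d z 0]/psum big_ord0 mulr0 addr0.
Qed.

(** With [x = T * nm z], the error splits into N terms of size at most [2 * M ^+ 2 * x ^+ N] and one
    of size at most [M ^+ 2 * x ^+ N]. As 2 N + 1 is at most 3 * 2^N, doubling T absorbs the number
    of terms. *)
Lemma hs_mul f g c d : hs f c -> hs g d -> hs (fun z => f z * g z) (conv c d).
Proof.
move=> Hf Hg; have [M [T [M0 T0 {}Hf {}Hg]]] := hs2 Hf Hg.
exists (3 * M ^+ 2), (2 * T); split; first by rewrite mulr_ge0// exprn_ge0// ltW.
  by lra.
move=> N z Tz; set x := T * nm z.
have x0 : 0 <= x by rewrite mulr_ge0 ?nm_ge0// ltW.
have x1 : x <= 1 by rewrite /x in x0 *; lra.
have gM : nm (g z) <= M.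
  by have := Hg 0%N z x1; rewrite /psum big_ord0 subr0 mulr1.
have cM i : nm (c i * z ^+ i) <= 2 * M * x ^+ i.
  by rewrite nmM nmX exprMn mulrA ler_wpM2r ?exprn_ge0 ?nm_ge0// (expands_coef T0 Hf).
have -> : f z * g z - psum (conv c d) z N =
    \sum_(i < N) c i * z ^+ i * (g z - psum d z (N - i)) + (f z - psum c z N) * g z.
  rewrite psum_conv mulrBl {1}/psum mulr_suml.
  under [X in _ = X + _]eq_bigr do rewrite mulrBr.
  by rewrite sumrB; ring.
apply: le_trans (nmD _ _) _.
apply: (@le_trans _ _ (\sum_(i < N) 2 * M ^+ 2 * x ^+ N + M ^+ 2 * x ^+ N)).
  apply: lerD.
    apply: le_trans (nm_sum _ _ _) _; apply: ler_sum => i _; rewrite nmM.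
    have -> : 2 * M ^+ 2 * x ^+ N = (2 * M * x ^+ i) * (M * x ^+ (N - i)).
      have -> : x ^+ N = x ^+ i * x ^+ (N - i) by rewrite -exprD subnKC// ltnW.
      by ring.
    by apply: ler_pM; rewrite ?nm_ge0//; exact: Hg.
  rewrite nmM (_ : M ^+ 2 * _ = (M * x ^+ N) * M); last by ring.
  by apply: ler_pM; rewrite ?nm_ge0//; exact: Hf.
rewrite sumr_const card_ord -[2 * T * _]mulrA -/x -[X in X + _]mulr_natl [(2 * x) ^+ N]exprMn.
have P : 0 <= M ^+ 2 * x ^+ N by rewrite mulr_ge0// exprn_ge0// ltW.
have := ler_wpM2l P (natr_le_expr2 N).
have : M ^+ 2 * x ^+ N * 1 <= M ^+ 2 * x ^+ N * 2 ^+ N.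
  by rewrite ler_wpM2l// exprn_ege1// ler1n.
by lra.
Qed.

Lemma hs_add f g c d : hs f c -> hs g d -> hs (fun z => f z + g z) (fun n => c n + d n).
Proof.
move=> Hf Hg; have [M [T [M0 T0 {}Hf {}Hg]]] := hs2 Hf Hg.
exists (M + M), T; split; try lra; move=> N z Tz.
have -> : f z + g z - psum (fun n => c n + d n) z N =
    (f z - psum c z N) + (g z - psum d z N).
  by rewrite /psum; under eq_bigr do rewrite mulrDl; rewrite big_split /=; ring.
by rewrite mulrDl; apply: le_trans (nmD _ _) (lerD (Hf _ _ Tz) (Hg _ _ Tz)).
Qed.

Lemma hs_scale f c (k : C) : hs f c -> hs (fun z => k * f z) (fun n => k * c n).
Proof.
move=> [M [T [M0 T0 H]]]; exists (nm k * M), T; split=> //.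
  by rewrite mulr_ge0// nm_ge0.
move=> N z Tz; rewrite -mulrA (_ : _ - _ = k * (f z - psum c z N)).
  by rewrite nmM ler_wpM2l ?nm_ge0// H.
by rewrite mulrBr /psum mulr_sumr; under eq_bigr do rewrite -mulrA.
Qed.

Lemma hs_sub f g c d : hs f c -> hs g d -> hs (fun z => f z - g z) (fun n => c n - d n).
Proof.
move=> Hf /(@hs_scale _ _ (-1)) Hg; have := hs_add Hf Hg.
by under eq_fun do rewrite mulN1r; under [X in hs _ X -> _]eq_fun do rewrite mulN1r.
Qed.

Lemma hs_monom k : hs (fun z => z ^+ k) (fun n => (n == k)%:R).
Proof.
apply: hs_of_cvg.
  exists 1, 1; split=> // n; rewrite expr1n mulr1.
  by case: eqP => _; rewrite ?nm1 ?nm0.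
exists 1 => // z _; apply/cvg_seqP => e e0; exists k.+1 => n kn.
rewrite power_seriesE /psum (bigD1 (Ordinal kn)) //= eqxx mul1r big1 ?addr0 ?subrr ?nm0//.
by move=> i; rewrite -val_eqE /= => /negbTE ->; rewrite mul0r.
Qed.

Lemma hs_cst (k : C) : hs (fun=> k) (fun n => if n is 0%N then k else 0).
Proof.
have := hs_scale k (hs_monom 0).
congr hs; first by apply/funext => z; rewrite expr0 mulr1.
by apply/funext => -[|n]; rewrite /= ?mulr1 ?mulr0.
Qed.

(** At a zero z, the first nonzero coefficient satisfies [nm (c n) <= M * T ^+ n.+1 * nm z], so
    zeros other than 0 stay away from 0. Only accumulating zeros are asked for, since functions will
    be compared on one ray of a slit disc. *)
Lemma hs_coef_eq0 f c : hs f c ->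
  (forall e, 0 < e -> exists z, [/\ z != 0, nm z < e & f z = 0]) -> forall n, c n = 0.
Proof.
move=> [M [T [M0 T0 H]]] F n; elim/ltn_ind: n => n IH.
apply/eqP; rewrite -nm_eq0; apply: contraT => cn0.
have {}cn0 : 0 < nm (c n) by rewrite lt_def cn0 nm_ge0.
have MT : 0 <= M * T ^+ n.+1 by rewrite mulr_ge0// exprn_ge0// ltW.
have MT1 : 0 < M * T ^+ n.+1 + 1 by lra.
have [|z [z0]] := F (Num.min T^-1 (nm (c n) / (M * T ^+ n.+1 + 1))).
  by rewrite lt_min invr_gt0 T0 divr_gt0.
rewrite lt_min => /andP[zT zc] fz; have := H n.+1 z.
rewrite -ler_pdivlMl// mulr1 ltW// => /(_ isT).
rewrite fz sub0r nmN psumS /psum big1 ?add0r => [|i _]; last by rewrite IH// mul0r.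
have nz0 : 0 < nm z by rewrite nm_gt0.
rewrite nmM nmX exprMn mulrA [nm z ^+ n.+1]exprSr mulrA [leRHS]mulrAC.
rewrite ler_pM2r ?exprn_gt0// => le1.
by move: zc; rewrite ltr_pdivlMr//; nra.
Qed.

Lemma hs_coef_uniq f g c d : hs f c -> hs g d ->
  (forall e, 0 < e -> exists z, [/\ z != 0, nm z < e & f z = g z]) -> c = d.
Proof.
move=> Hf Hg F; apply/funext => n; apply/eqP; rewrite -subr_eq0; apply/eqP.
apply: (hs_coef_eq0 (hs_sub Hf Hg)) => e /F[z [z0 ze fg]].
by exists z; split=> //; rewrite fg subrr.
Qed.

Lemma exists_small e : 0 < e -> exists z : C, z != 0 /\ nm z < e.
Proof.
move=> e0; exists (inC (e / 2)); rewrite -nm_eq0 nm_inC ger0_norm; last by lra.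
by split; lra.
Qed.

Lemma hs_coef_near f g c d : hs f c -> hs g d ->
  near0 (fun z => z != 0 -> f z = g z) -> c = d.
Proof.
move=> Hf Hg [e e0 H]; apply: (hs_coef_uniq Hf Hg) => e' e'0.
have [|z [z0 ze]] := @exists_small (Num.min e e'); first by rewrite lt_min e0.
by move: ze; rewrite lt_min => /andP[ze ze']; exists z; rewrite H.
Qed.

Definition shiftS c n := c n.+1.

Lemma hs_shift f c : hs f c ->
  exists F, hs F (shiftS c) /\ near0 (fun z => f z = c 0%N + z * F z).
Proof.
move=> Hf; have [M [T [M0 T0 H]]] := hs_geo Hf.
have [|F HF] := @geo_hs _ (shiftS c).
  exists (M * T), T; split=> //; first by rewrite mulr_ge0// ltW.
  by move=> n; rewrite -mulrA -exprS H.
exists F; split=> //; apply: (hs_uniq Hf).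
have := hs_add (hs_cst (c 0%N)) (hs_mul (hs_monom 1) HF).
congr hs; apply/funext => -[|n]; rewrite /conv.
  by rewrite big_ord1 mul0r addr0.
rewrite add0r (bigD1 (lift ord0 ord0)) //= mul1r subSS subn0 big1 ?addr0 //.
by move=> i; rewrite -val_eqE /= => /negbTE ->; rewrite mul0r.
Qed.

Definition derivS c n : C := n.+1%:R * c n.+1.

(** The factor [r ^+ 2] avoids the exponent n - 2. The remainders satisfy E(n+1) = (z + h) E(n) + n
    z^(n-1) h^2; as z + h has modulus at most 2 r, growth by 4 r per step leaves room for the last
    term. *)
Lemma expand_remainder (z h : C) (r : R) n : 0 < r -> nm z <= r -> nm h <= r ->
  nm ((z + h) ^+ n - z ^+ n - h * (n%:R * z ^+ n.-1)) * r ^+ 2 <=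
  (4 * r) ^+ n * nm h ^+ 2.
Proof.
move=> r0 zr hr; elim: n => [|n IH].
  rewrite !expr0 subrr !mul0r mulr0 subr0 nm0 mul0r mul1r exprn_ge0//.
  exact: nm_ge0.
set E := _ - _ - _ in IH.
have -> : (z + h) ^+ n.+1 - z ^+ n.+1 - h * (n.+1%:R * z ^+ n.+1.-1) =
    (z + h) * E + n%:R * z ^+ n.-1 * h ^+ 2.
  rewrite /E; case: n {IH E} => [|n] /=; first by rewrite !expr0 !expr1; ring.
  by rewrite !exprS -!natr1; ring.
have zh : nm (z + h) <= 2 * r by have := nmD z h; lra.
have h2 : 0 <= nm h ^+ 2 by rewrite exprn_ge0// nm_ge0.
have B2 : nm (n%:R * z ^+ n.-1 * h ^+ 2) * r <= n%:R * r ^+ n * nm h ^+ 2.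
  rewrite !nmM nm_nat !nmX; case: n {IH E} => [|n] /=; first by rewrite !mul0r.
  rewrite mulrAC ler_wpM2r// -mulrA ler_wpM2l// exprSr ler_wpM2r ?(ltW r0)//.
  by rewrite lerXn2r ?nnegrE ?nm_ge0// ltW.
have B1 : nm ((z + h) * E) * r ^+ 2 <= 2 * r * ((4 * r) ^+ n * nm h ^+ 2).
  by rewrite nmM -mulrA ler_pM ?mulr_ge0 ?nm_ge0 ?exprn_ge0// ltW.
apply: (@le_trans _ _ (2 * r * ((4 * r) ^+ n * nm h ^+ 2) + n%:R * r ^+ n * nm h ^+ 2 * r)).
  apply: (@le_trans _ _ ((nm ((z + h) * E) + nm (n%:R * z ^+ n.-1 * h ^+ 2)) * r ^+ 2)).
    by rewrite ler_wpM2r ?nmD// exprn_ge0// ltW.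
  by rewrite mulrDl lerD// [r ^+ 2]expr2 [leLHS]mulrA ler_wpM2r// ltW.
have nn : n%:R <= (4 : R) ^+ n.
  by apply: le_trans (natr_le_expr2 n) _; rewrite lerXn2r ?nnegrE//; lra.
have P : 0 <= r ^+ n * nm h ^+ 2 * r by rewrite !mulr_ge0 ?exprn_ge0 ?nm_ge0// ltW.
have := ler_wpM2r P nn; rewrite [(4 * r) ^+ n.+1]exprS ![(4 * r) ^+ n]exprMn.
have : 0 <= 4 ^+ n * (r ^+ n * nm h ^+ 2 * r) by rewrite mulr_ge0// exprn_ge0.
by lra.
Qed.

Lemma hs_deriv f c : hs f c -> exists f', hs f' (derivS c) /\
  near0 (fun z => is_derive z 1 f (f' z)).
Proof.
move=> Hf; have [M [T [M0 T0 H]]] := hs_geo Hf.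
have [|f' Hf'] := @geo_hs _ (derivS c).
  exists (M * T), (2 * T); split=> //; [by rewrite mulr_ge0// ltW| by lra|].
  move=> n; rewrite nmM nm_nat.
  have -> : M * T * (2 * T) ^+ n = 2 ^+ n * (M * T ^+ n.+1).
    by rewrite exprMn exprS; ring.
  by rewrite ler_pM ?nm_ge0// -natrX ler_nat ltn_expl.
exists f'; split=> //.
have [e e0 He] := near0_and (hs_cvg Hf) (hs_cvg Hf').
(* The first bound makes [4 * (T * r)], the ratio of the summed remainders, at most 1/2; the second
   keeps z + h in the disc of convergence. *)
pose r := Num.min (8 * T)^-1 (e / 2).
have r0 : 0 < r by rewrite lt_min invr_gt0 !divr_gt0 ?andbT//; lra.
have rT : 4 * (T * r) <= 2^-1.
  have : r <= (8 * T)^-1 by rewrite ge_min lexx.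
  by rewrite -(ler_pM2l T0) invfM mulrCA divff ?gt_eqF// mulr1; lra.
have re : r <= e / 2 by rewrite ge_min lexx orbT.
exists r => // z zr; apply/is_deriveP => d d0.
pose K := 2 * M / r ^+ 2.
have K0 : 0 <= K by rewrite divr_ge0 ?exprn_ge0 ?(ltW r0)//; lra.
exists (Num.min r (d / (K + 1))).
  by rewrite lt_min r0 divr_gt0//; lra.
move=> h; rewrite lt_min => /andP[hr hd].
have zh : nm (z + h) < e by have := nmD z h; lra.
have [|Hz Hz'] := He z; first by lra.
have [Hzh _] := He _ zh.
have KH : nm (f (z + h) - f z - h * f' z) <= K * nm h ^+ 2.
  (* The indices are offset by one because the term of index n in the derived series comes from
     [c n.+1]; this makes [u n] exactly a sum of remainders. *)
  pose u n : C := power_series c (z + h) n.+1 - power_series c z n.+1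
                  - h * power_series (derivS c) z n.
  have uS (v : nat -> C) (l : C) : v @ \oo --> l -> (fun n => v n.+1) @ \oo --> l.
    by move=> /cvg_seqP vl; apply/cvg_seqP => a /vl[N HN]; exists N => n Nn; rewrite HN// leqW.
  have ul : u @ \oo --> f (z + h) - f z - h * f' z.
    rewrite /u; exact: (@cvg_subM C (fun n => power_series c (z + h) n.+1)
      (fun n => power_series c z n.+1) (power_series (derivS c) z) _ _ _ h
      (uS _ _ Hzh) (uS _ _ Hz) Hz').
  rewrite -[X in nm X]subr0; apply: (cvg_nm_le (N := 0%N) ul) => n _; rewrite subr0.
  have -> : u n = \sum_(k < n.+1)
      c k * ((z + h) ^+ k - z ^+ k - h * (k%:R * z ^+ k.-1)).
    under eq_bigr do rewrite !mulrBr.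
    rewrite !sumrB /u !power_seriesE /psum; congr (_ - _).
    rewrite big_ord_recl /= mul0r !mulr0 add0r mulr_sumr.
    by apply: eq_bigr => i _; rewrite /derivS /bump /= add1n; ring.
  apply: le_trans (nm_sum _ _ _) _.
  apply: (@le_trans _ _ (\sum_(k < n.+1) M / r ^+ 2 * nm h ^+ 2 * (4 * (T * r)) ^+ k)).
    apply: ler_sum => k _; rewrite nmM.
    have := expand_remainder k r0 (ltW zr) (ltW hr).
    rewrite -ler_pdivlMr ?exprn_gt0// => le1.
    apply: le_trans (ler_pM (nm_ge0 _) (nm_ge0 _) (H k) le1) _.
    by rewrite mulrCA !exprMn; rewrite le_eqVlt; apply/orP; left; apply/eqP; ring.
  rewrite -mulr_sumr (_ : K * nm h ^+ 2 = M / r ^+ 2 * nm h ^+ 2 * 2); last first.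
    by rewrite /K; ring.
  rewrite ler_wpM2l ?geo_sum_le//; first by rewrite !mulr_ge0 ?invr_ge0 ?exprn_ge0 ?nm_ge0// ltW.
  by rewrite mulr_ge0// mulr_ge0// ltW.
apply: le_trans KH _; rewrite expr2 mulrA ler_wpM2r ?nm_ge0//.
by move: hd; rewrite ltr_pdivlMr; [have := nm_ge0 h; nra|lra].
Qed.

End Operations.

(** * Recursions with geometric bounds *)

Section Recursions.
Variable R : realType.
Local Notation C := (Cx R).
Implicit Types (c d : nat -> C).

(** Values are accumulated in a list. [x0] is what [nth] returns past its end, at indices that [F n]
    does not inspect. *)
Lemma strong_recursion (V : Type) (x0 : V) (F : nat -> (nat -> V) -> V) :
  (forall n u v, (forall k, (k < n)%N -> u k = v k) -> F n u = F n v) ->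
  exists v, forall n, v n = F n v.
Proof.
move=> HF.
pose s := fix s n := if n is m.+1 then rcons (s m) (F m (nth x0 (s m))) else [::].
have sS n : s n.+1 = rcons (s n) (F n (nth x0 (s n))) by [].
have size_s n : size (s n) = n by elim: n => //= n IH; rewrite size_rcons IH.
have nth_s k n : (k < n)%N -> nth x0 (s n) k = nth x0 (s k.+1) k.
  elim: n => // n IH; rewrite ltnS leq_eqVlt => /orP[/eqP -> //|kn].
  by rewrite sS nth_rcons size_s kn IH.
exists (fun n => nth x0 (s n.+1) n) => n.
rewrite sS nth_rcons size_s ltnn eqxx.
by apply: HF => k kn; rewrite nth_s.
Qed.

(** The part of [conv c d n] that involves only [d k] with k < n, hence the known terms when a
    recursion is solved for [d n]. *)
Definition pconv c d n : C := \sum_(k < n) c (n - k)%N * d k.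

Lemma convE c d n : conv c d n = c 0%N * d n + pconv c d n.
Proof.
rewrite /conv (reindex_inj rev_ord_inj) /= big_ord_recr /= subSS subnn subn0 addrC.
by congr (_ + _); apply: eq_bigr => i _; rewrite subSS subKn// ltnW.
Qed.

Lemma eq_pconv c d d' n : (forall k, (k < n)%N -> d k = d' k) -> pconv c d n = pconv c d' n.
Proof. by move=> H; apply: eq_bigr => i _; rewrite H. Qed.

Lemma pconv_le c d (M T : R) n : (forall k, nm (c k) <= M * T ^+ k) ->
  nm (pconv c d n) <= M * \sum_(k < n) T ^+ (n - k) * nm (d k).
Proof.
move=> H; apply: le_trans (nm_sum _ _ _) _; rewrite mulr_sumr.
by apply: ler_sum => k _; rewrite nmM mulrA ler_wpM2r ?nm_ge0.
Qed.

(** The ratio [S = T * (1 + L)] solves the comparison recursion exactly: the weighted sum of the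
    powers of S is [S ^+ n - T ^+ n]. The constant B takes care of the indices below [n0]. *)
Lemma majorant (x : nat -> R) (L T : R) n0 : (forall n, 0 <= x n) -> 0 <= L -> 0 < T ->
  (forall n, (n0 <= n)%N -> x n <= L * \sum_(k < n) T ^+ (n - k) * x k) ->
  exists B S, [/\ 0 <= B, 0 < S & forall n, x n <= B * S ^+ n].
Proof.
move=> x0 L0 T0 H; pose S := T * (1 + L).
have S0 : 0 < S by rewrite mulr_gt0//; lra.
have SX n : 0 < S ^+ n by rewrite exprn_gt0.
pose B := \sum_(k < n0) x k / S ^+ k.
have B0 : 0 <= B by apply: sumr_ge0 => k _; rewrite divr_ge0// ltW.
exists B, S; split=> //.
have G n : L * \sum_(k < n) T ^+ (n - k) * S ^+ k = S ^+ n - T ^+ n.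
  elim: n => [|n IH]; first by rewrite big_ord0 mulr0 !expr0 subrr.
  rewrite big_ord_recr /= subSnn expr1.
  have -> : \sum_(k < n) T ^+ (n.+1 - k) * S ^+ k = T * \sum_(k < n) T ^+ (n - k) * S ^+ k.
    by rewrite mulr_sumr; apply: eq_bigr => k _; rewrite subSn ?exprS ?mulrA// ltnW.
  by rewrite mulrDr mulrCA IH !exprS /S; ring.
elim/ltn_ind => n IH; have [n0n|nn0] := leqP n0 n; last first.
  rewrite -ler_pdivrMr// /B (bigD1 (Ordinal nn0)) //= lerDl.
  by apply: sumr_ge0 => k _; rewrite divr_ge0// ltW.
apply: le_trans (H n n0n) _.
apply: (@le_trans _ _ (B * (L * \sum_(k < n) T ^+ (n - k) * S ^+ k))).
  rewrite mulrCA ler_wpM2l// mulr_sumr; apply: ler_sum => k _.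
  by rewrite mulrCA ler_wpM2l ?IH// exprn_ge0// ltW.
by rewrite G ler_wpM2l// lerBlDr lerDl exprn_ge0// ltW.
Qed.

Lemma hs_inv (g : C -> C) c : hs g c -> c 0%N != 0 -> exists d, hs (fun z => (g z)^-1) d.
Proof.
move=> Hg c0.
have [d Hd] := @strong_recursion C 0
  (fun n d => if n is 0%N then (c 0%N)^-1 else - (c 0%N)^-1 * pconv c d n)
  (ltac:(by move=> [|n] u v uv //; rewrite (eq_pconv _ uv))).
have cd : conv c d = (fun n => if n is 0%N then 1 else 0).
  apply/funext => n; rewrite convE {1}Hd; case: n => [|n].
    by rewrite divff// /pconv big_ord0 addr0.
  by rewrite mulrA mulrN divff// mulN1r addrC subrr.
have [M [T [M0 T0 H]]] := hs_geo Hg.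
have gd : geo d.
  apply: (@majorant (fun n => nm (d n)) (nm (c 0%N)^-1 * M) T 1) => //.
  - by move=> n; apply: nm_ge0.
  - by rewrite mulr_ge0// nm_ge0.
  move=> [|n] // _; rewrite Hd mulNr nmN nmM -mulrA ler_wpM2l ?nm_ge0//.
  exact: pconv_le.
have [f Hf] := geo_hs gd; exists d; apply: (hs_ext _ Hf).
have := hs_mul Hg Hf; rewrite cd => /hs_uniq /(_ (hs_cst 1)).
apply: near0_sub => z gf.
have g0 : g z != 0 by apply: contra_eq_neq gf => ->; rewrite mul0r eq_sym oner_eq0.
by apply: (mulfI g0); rewrite gf divff.
Qed.

(** Meant for the coefficients of the solved Frobenius recursion, which are quotients of naturals
    bounded by 1. *)
Lemma nm_ratio (p r : nat) (X : C) : (p <= r)%N -> (0 < r)%N ->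
  nm (p%:R * X / r%:R) <= nm X.
Proof.
move=> pr r0; rewrite !nmM nmV !nm_nat mulrAC ler_piMl ?nm_ge0//.
by rewrite ler_pdivrMr ?ltr0n// mul1r ler_nat.
Qed.

End Recursions.

(** * Frobenius series of the reduced system *)

Section Frobenius.
Variable R : realType.
Local Notation C := (Cx R).
Variables (al be de : nat -> C).

(* Writing mu_+, mu_-, z nu as z^(-2/3) times power series with coefficients
   v MuPlus, v MuMinus, v Nu. *)
Definition formal_solution (v : unknown -> nat -> C) := forall n,
  [/\ 3 * n%:R * v MuPlus n = 2 * conv al (v MuPlus) n - v Nu n,
      (3 * n%:R - 4) * v MuMinus n = - 2 * conv al (v MuMinus) n + v Nu n &
      (3 * n%:R - 5) * v Nu n = 2 * conv be (v MuMinus) n - 2 * conv de (v MuPlus) n].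

Hypotheses (gal : geo al) (gbe : geo be) (gde : geo de).
Hypotheses (al0 : al 0%N = 0) (al1 : al 1%N = 0).
Hypotheses (be0 : be 0%N = 1) (be1 : be 1%N = 0).
Hypotheses (de0 : de 0%N = 0) (de1 : de 1%N = 0) (de2 : de 2%N = 0).
Variables c0 c1 c2 : C.

(* At order n the equations for the last two unknowns have determinant
   9 (n - 1) (n - 2), hence the free constants c1 and c2; c0 is the free constant
   at n = 0. *)
Lemma frobenius : exists v : unknown -> nat -> C,
  [/\ formal_solution v, forall x, geo (v x),
    [/\ v MuPlus 0%N = c0, v MuMinus 0%N = 0 & v Nu 0%N = 0],
    [/\ v MuPlus 1%N = c1 / 3, v MuMinus 1%N = c1 & v Nu 1%N = - c1] &
    [/\ v MuPlus 2%N = (al 2%N * c0 - c2) / 3, v MuMinus 2%N = c2 & v Nu 2%N = 2 * c2]].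
Proof.
pose K (u : nat -> C * C * C) n := (u n).1.1.
pose M (u : nat -> C * C * C) n := (u n).1.2.
pose S (u : nat -> C * C * C) n := (u n).2.
pose R1 u n : C := 2 * pconv al (K u) n.
pose R2 u n : C := - 2 * pconv al (M u) n.
pose R3 u n : C := 2 * pconv be (M u) n - 2 * pconv de (K u) n.
pose det k : nat := (9 * (k.+1 * k.+2))%N.
have detP k : [/\ 0 < det k, 1 <= det k, 2 <= det k, 3 * k + 4 <= det k & 3 * k + 5 <= det k]%N.
  by rewrite /det; split; nia.
(* Cramer's rule at order n = k + 3 for (3 n - 4) M - S = R2 and (3 n - 5) S - 2 M = R3. The factors
   [1%:R] and [2%:R] give every term the shape required by [nm_ratio]. *)
pose sM u k : C := (3 * k + 4)%:R * R2 u k.+3 / (det k)%:R + 1%:R * R3 u k.+3 / (det k)%:R.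
pose sS u k : C := 2%:R * R2 u k.+3 / (det k)%:R + (3 * k + 5)%:R * R3 u k.+3 / (det k)%:R.
pose sK u k : C := 1%:R * (R1 u k.+3 - sS u k) / (3 * k.+3)%:R.
(* At n = 1 and n = 2 the vanishing low coefficients, together with M = 0 at order 0, leave the
   homogeneous relations S = - M and S = 2 M. Each is counted twice, so both orders are solvable
   with a free constant. *)
pose F n u : C * C * C := match n with
  | 0 => (c0, 0, 0) | 1 => (c1 / 3, c1, - c1)
  | 2 => ((al 2%N * c0 - c2) / 3, c2, 2 * c2)
  | k.+3 => (sK u k, sM u k, sS u k) end.
have [|u Hu] := @strong_recursion _ (0, 0, 0) F.
  move=> [|[|[|n]]] // u v uv; rewrite /F /sK /sM /sS /R1 /R2 /R3.
  have eK c : pconv c (K u) n.+3 = pconv c (K v) n.+3.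
    by apply: eq_pconv => k kn; rewrite /K uv.
  have eM c : pconv c (M u) n.+3 = pconv c (M v) n.+3.
    by apply: eq_pconv => k kn; rewrite /M uv.
  by rewrite !eK !eM.
have det0 k : (det k)%:R != 0 :> C by rewrite pnatr_eq0.
have k30 k : (3 * k.+3)%:R != 0 :> C by rewrite pnatr_eq0.
have u0 := Hu 0%N; have u1 := Hu 1%N; have u2 := Hu 2%N.
exists (fun x => match x with MuPlus => K u | MuMinus => M u | Nu => S u end); split.
- move=> n; rewrite !convE al0 be0 de0 !mul0r !mul1r !add0r.
  have pc c d m : pconv c d m = \sum_(k < m) c (m - k)%N * d k by [].
  case: n => [|[|[|n]]].
  + by rewrite !pc !big_ord0 /K /M /S u0 /=; split; ring.
  + rewrite !pc !big_ord1 /K /M /S u0 u1 /= ?al1 ?be1 ?de1.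
    by split; field.
  + rewrite !pc !big_ord_recl !big_ord0 /K /M /S u0 u1 u2 /= ?al1 ?be1 ?de1 ?de2.
    by split; field.
  + have -> : K u n.+3 = sK u n by rewrite /K Hu.
    have -> : M u n.+3 = sM u n by rewrite /M Hu.
    have -> : S u n.+3 = sS u n by rewrite /S Hu.
    have E1 : pconv al (K u) n.+3 = R1 u n.+3 / 2 by rewrite /R1; field.
    have E2 : pconv al (M u) n.+3 = - R2 u n.+3 / 2 by rewrite /R2; field.
    have E3 : pconv be (M u) n.+3 = R3 u n.+3 / 2 + pconv de (K u) n.+3.
      by rewrite /R3; field.
    rewrite E1 E2 E3 /sK.
    have detE : (det n)%:R = 9 * ((n%:R + 1) * (n%:R + 2)) :> C.
      by rewrite /det natrM natrM -!natr1; ring.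
    have n3 : n.+3%:R = n%:R + 3 :> C by rewrite -!natr1; ring.
    have n3' : (3 * n.+3)%:R = 3 * (n%:R + 3) :> C by rewrite natrM n3.
    have d0 := det0 n; have k0 := k30 n; rewrite detE in d0; rewrite n3' in k0.
    move: d0 k0; rewrite !mulf_eq0 !negb_or => /and3P[_ d1 d2] /andP[_ d3].
    have e4 : (3 * n + 4)%:R = 3 * n%:R + 4 :> C by rewrite natrD natrM.
    have e5 : (3 * n + 5)%:R = 3 * n%:R + 5 :> C by rewrite natrD natrM.
    rewrite /sM /sS detE n3 n3' e4 e5; set a := n%:R in d1 d2 d3 *.
    by split; field; rewrite ?d1 ?d2 ?d3.
- have [A [T [A0 T0 Hal]]] := gal.
  have [B [T' [B0 T'0 Hbe]]] := gbe.
  have [D [T'' [D0 T''0 Hde]]] := gde.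
  pose Q := A + B + D; pose U := T + T' + T''.
  have WW (c : nat -> C) (a t : R) : 0 <= a -> 0 < t -> a <= Q -> t <= U ->
      (forall k, nm (c k) <= a * t ^+ k) -> forall k, nm (c k) <= Q * U ^+ k.
    move=> a0 t0 aQ tU H k; apply: le_trans (H k) _.
    apply: ler_pM => //; first by rewrite exprn_ge0// ltW.
    by rewrite lerXn2r ?nnegrE// ltW// (lt_le_trans t0).
  have {}Hal : forall k, nm (al k) <= Q * U ^+ k by apply: WW Hal => //; rewrite /Q /U; lra.
  have {}Hbe : forall k, nm (be k) <= Q * U ^+ k by apply: WW Hbe => //; rewrite /Q /U; lra.
  have {}Hde : forall k, nm (de k) <= Q * U ^+ k by apply: WW Hde => //; rewrite /Q /U; lra.
  have Q0 : 0 <= Q by rewrite /Q; lra.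
  have U0 : 0 < U by rewrite /U; lra.
  (* The three recursions are coupled, so their sum is majorised. From order 3 on the terms are at
     most 8 G, 6 G and 6 G, well below 30 G. *)
  pose x n := nm (K u n) + nm (M u n) + nm (S u n).
  have Ku n : nm (K u n) <= x n by rewrite /x; have := nm_ge0 (M u n); have := nm_ge0 (S u n); lra.
  have Mu n : nm (M u n) <= x n by rewrite /x; have := nm_ge0 (K u n); have := nm_ge0 (S u n); lra.
  have Su n : nm (S u n) <= x n by rewrite /x; have := nm_ge0 (M u n); have := nm_ge0 (K u n); lra.
  have pb (c d : nat -> C) n : (forall k, nm (c k) <= Q * U ^+ k) ->
      (forall k, nm (d k) <= x k) ->
      nm (pconv c d n) <= Q * \sum_(k < n) U ^+ (n - k) * x k.
    move=> Hc Hd; apply: le_trans (pconv_le _ _ Hc) _; rewrite ler_wpM2l//.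
    by apply: ler_sum => k _; rewrite ler_wpM2l// exprn_ge0// ltW.
  have x0 n : 0 <= x n by rewrite /x !addr_ge0// nm_ge0.
  have Q30 : 0 <= 30 * Q by lra.
  have [|X [W [X0 W0 H]]] := @majorant _ x (30 * Q) U 3 x0 Q30 U0.
  - move=> n; case: n => [|[|[|n]]] // _; rewrite -mulrA; set G := Q * _.
    have G1 : nm (pconv al (K u) n.+3) <= G by apply: pb.
    have G2 : nm (pconv al (M u) n.+3) <= G by apply: pb.
    have G3 : nm (pconv be (M u) n.+3) <= G by apply: pb.
    have G4 : nm (pconv de (K u) n.+3) <= G by apply: pb.
    have r1 : nm (R1 u n.+3) <= 2 * G by rewrite /R1 nmM (nm_nat _ 2); lra.
    have r2 : nm (R2 u n.+3) <= 2 * G by rewrite /R2 mulNr nmN nmM (nm_nat _ 2); lra.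
    have r3 : nm (R3 u n.+3) <= 4 * G.
      by apply: le_trans (nmB _ _) _; rewrite !nmM (nm_nat _ 2); lra.
    rewrite /x {1}/K {1}/M {1}/S Hu /=.
    have [dp A1 A4 A2 A3] := detP n.
    have hM : nm (sM u n) <= 6 * G.
      apply: le_trans (nmD _ _) _.
      have := @nm_ratio R (3 * n + 4) (det n) (R2 u n.+3); have := @nm_ratio R 1 (det n) (R3 u n.+3).
      by move=> /(_ A1 dp) ? /(_ A2 dp) ?; lra.
    have hS : nm (sS u n) <= 6 * G.
      apply: le_trans (nmD _ _) _.
      have := @nm_ratio R 2 (det n) (R2 u n.+3).
      have := @nm_ratio R (3 * n + 5) (det n) (R3 u n.+3).
      by move=> /(_ A3 dp) ? /(_ A4 dp) ?; lra.
    have hK : nm (sK u n) <= 8 * G.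
      have := @nm_ratio R 1 (3 * n.+3) (R1 u n.+3 - sS u n).
      move=> /(_ isT isT) /le_trans; apply.
      by apply: le_trans (nmB _ _) _; lra.
    have : 0 <= G by apply: le_trans (nm_ge0 _) G1.
    by lra.
  - by case; exists X, W; split=> // n; apply: le_trans (H n).
- by rewrite /K /M /S u0.
- by rewrite /K /M /S u1.
- by rewrite /K /M /S u2.
Qed.

End Frobenius.

(** * The solution q near a pole *)

Lemma is_derive_div (K : numFieldType) (f g : K -> K) (x df dg : K) :
  is_derive x 1 f df -> is_derive x 1 g dg -> g x != 0 ->
  is_derive x 1 (fun y => f y / g y) ((df * g x - f x * dg) / g x ^+ 2).
Proof.
move=> Hf Hg gx; have Hv : is_derive x 1 (fun y => (g y)^-1) (- (g x) ^- 2 *: dg).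
  apply: DeriveDef; first exact: derivableV.
  by rewrite deriveV// derive_val.
have H := is_deriveM Hf Hv; apply: is_derive_eq.
by rewrite /GRing.scale /=; field.
Qed.

Lemma is_derive_mul (K : numFieldType) (f g : K -> K) (x df dg : K) :
  is_derive x 1 f df -> is_derive x 1 g dg ->
  is_derive x 1 (fun y => f y * g y) (df * g x + f x * dg).
Proof.
move=> Hf Hg; have H := is_deriveM Hf Hg; apply: is_derive_eq.
by rewrite /GRing.scale /=; ring.
Qed.

Lemma is_derive_sub (K : numFieldType) (f g : K -> K) (x df dg : K) :
  is_derive x 1 f df -> is_derive x 1 g dg ->
  is_derive x 1 (fun y => f y - g y) (df - dg).
Proof. by move=> Hf Hg; exact: (is_deriveB Hf Hg). Qed.

Lemma is_derive_scale (K : numFieldType) (f : K -> K) (k x df : K) :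
  is_derive x 1 f df -> is_derive x 1 (fun y => k * f y) (k * df).
Proof. by move=> Hf; exact: (is_deriveZ k Hf). Qed.

Lemma is_derive_pow (K : numFieldType) (f : K -> K) (x df : K) n : is_derive x 1 f df ->
  is_derive x 1 (fun y => f y ^+ n) (n%:R * f x ^+ n.-1 * df).
Proof.
move=> Hf; rewrite (_ : (fun y => f y ^+ n) = f ^+ n); first exact: is_deriveX.
by apply/funext => y; rewrite exprfctE.
Qed.

Lemma is_derive_id1 (K : numFieldType) (x : K) : is_derive x 1 (fun y : K => y) 1.
Proof. exact: is_derive_id. Qed.

Lemma derive1_val (K : numFieldType) (f : K -> K) (x df : K) :
  is_derive x 1 f df -> derive1 f x = df.
Proof. by move=> H; rewrite derive1E derive_val. Qed.

Lemma derivable1_derive1 (K : numFieldType) (f : K -> K) (x : K) :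
  derivable f x 1 -> is_derive x 1 f (derive1 f x).
Proof. by move=> H; rewrite derive1E; exact: derivableP. Qed.

Section Poles.
Variable R : realType.
Local Notation C := (Cx R).
Implicit Types (f g : C -> C) (c : nat -> C) (z : C).

Lemma is_derive_shift1 f (a z df : C) :
  is_derive z 1 (fun z => f (a + z)) df <-> is_derive (a + z) 1 f df.
Proof.
split=> /is_deriveP H; apply/is_deriveP => e /H[d d0 Hd]; exists d => // h /Hd.
  by rewrite addrA.
by rewrite addrA.
Qed.

Lemma is_derive_near f g (a df : C) (e : R) : 0 < e ->
  (forall h, nm h < e -> f (a + h) = g (a + h)) -> is_derive a 1 f df -> is_derive a 1 g df.
Proof.
move=> e0 fg /is_deriveP H; apply/is_deriveP => e' /H[d d0 Hd].
exists (Num.min d e); first by rewrite lt_min d0.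
move=> h; rewrite lt_min => /andP[hd he]; have := Hd h hd; rewrite fg//.
by have := fg 0; rewrite nm0 e0 addr0 => ->.
Qed.

Lemma is_derive_continuous f (a df : C) : is_derive a 1 f df ->
  exists e B : R, 0 < e /\ forall h, nm h < e -> nm (f (a + h)) <= B.
Proof.
move=> /is_deriveP /(_ 1 ltr01)[d d0 H].
exists (Num.min d 1), (1 + nm df + nm (f a)); split; first by rewrite lt_min d0 ltr01.
move=> h; rewrite lt_min => /andP[hd h1]; have := H h hd; rewrite mul1r => le1.
have -> : f (a + h) = (f (a + h) - f a - h * df) + h * df + f a by ring.
have := nmD (f (a + h) - f a - h * df + h * df) (f a).
have := nmD (f (a + h) - f a - h * df) (h * df); rewrite [nm (h * df)]nmM.
by have := nm_ge0 df; have := nm_ge0 h; nra.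
Qed.

(** Abel's lemma: the terms at z are bounded. From index n on, a term is a difference of partial
    sums within 1 of the limit, whence the 2 in M. *)
Lemma cvg_geo c z (s : C) : z != 0 -> power_series c z @ \oo --> s -> geo c.
Proof.
move=> z0 /cvg_seqP /(_ 1 ltr01)[n Hn].
pose M := 2 + \sum_(k < n) nm (c k * z ^+ k).
have S0 : 0 <= \sum_(k < n) nm (c k * z ^+ k) by apply: sumr_ge0 => k _; exact: nm_ge0.
have n1 : 0 < nm z by rewrite nm_gt0.
exists M, (nm z)^-1; split; rewrite ?invr_gt0//; first by rewrite /M; lra.
move=> j; rewrite exprVn ler_pdivlMr ?exprn_gt0// -nmX -nmM.
have [nN|nN] := ltnP j n.
  rewrite /M (bigD1 (Ordinal nN)) //= addrCA lerDl addr_ge0//.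
  by apply: sumr_ge0 => k _; exact: nm_ge0.
have h1 := Hn _ nN; have h2 := Hn _ (leqW nN).
have := nmB (power_series c z j.+1 - s) (power_series c z j - s).
rewrite (_ : _ - _ = c j * z ^+ j); last by rewrite !power_seriesE psumS; ring.
by rewrite /M; lra.
Qed.

Lemma analytic_hs f (a : C) : analytic_at f a -> exists c, hs (fun z => f (a + z)) c.
Proof.
move=> [c /nearP[e e0 He]]; exists c.
have H z : nm z < e -> power_series c z @ \oo --> f (a + z).
  by move=> ze; have := He (a + z); rewrite [a + z]addrC addrK; apply.
apply: hs_of_cvg; last by exists e.
have [z [z0 ze]] := exists_small e0.
exact: cvg_geo z0 (H z ze).
Qed.

Lemma hs_continuous0 f c : hs f c -> forall e : R, 0 < e ->
  near0 (fun z => nm (f z - c 0%N) < e).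
Proof.
move=> [M [T [M0 T0 H]]] e e0; exists (Num.min T^-1 (e / (M * T + 1))).
  by rewrite lt_min invr_gt0 T0 divr_gt0// ltr_wpDl// mulr_ge0// ltW.
move=> z; rewrite lt_min => /andP[zT ze]; have := H 1%N z.
rewrite -ler_pdivlMl// mulr1 ltW// => /(_ isT).
rewrite expr1 /psum big_ord1 expr0 mulr1 => /le_lt_trans; apply.
have MT : 0 <= M * T by rewrite mulr_ge0// ltW.
move: ze; rewrite ltr_pdivlMr; last by lra.
by have := nm_ge0 z; nra.
Qed.

Lemma hs_neq0 f c : hs f c -> c 0%N != 0 -> near0 (fun z => f z != 0).
Proof.
move=> Hf c0; have := hs_continuous0 Hf; rewrite -nm_gt0 in c0 => /(_ _ c0).
apply: near0_sub => z; apply: contraTneq => ->.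
by rewrite sub0r nmN ltxx.
Qed.

Lemma hs_mulX f c : hs f c ->
  hs (fun z => z * f z) (fun n => if n is m.+1 then c m else 0).
Proof.
move=> Hf; have := hs_mul (hs_monom R 1) Hf.
congr hs; apply/funext => -[|n]; rewrite /conv; first by rewrite big_ord1 mul0r.
rewrite (bigD1 (lift ord0 ord0)) //= mul1r subSS subn0 big1 ?addr0 //.
by move=> i; rewrite -val_eqE /= => /negbTE ->; rewrite mul0r.
Qed.

(** Derivability bounds f near a, and then [g = f * h ^+ k] would tend to 0 there. With meromorphy
    this makes q analytic around its pole, where the equation may be used. *)
Lemma not_pole f (a df : C) : is_derive a 1 f df -> ~ is_pole f a.
Proof.
move=> Df [k [g [k0 /analytic_hs[c Hc] ga /near_punctP[e e0 He]]]].
have c0 : c 0%N = g a by rewrite -(hs0 Hc) addr0.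
have [e1 [B [e10 HB]]] := is_derive_continuous Df.
have B0 : 0 <= B by have := HB 0; rewrite nm0 => /(_ e10); apply: le_trans; exact: nm_ge0.
have gn : 0 < nm (g a) by rewrite nm_gt0.
have g2 : 0 < nm (g a) / 2 by rewrite divr_gt0.
have [e2 e20 H2] := hs_continuous0 Hc g2.
pose m := Num.min (Num.min e e1) (Num.min (Num.min e2 1) (nm (g a) / 2 / (B + 1))).
have m0 : 0 < m by rewrite !lt_min e0 e10 e20 ltr01 divr_gt0//; lra.
have [h [h0]] := exists_small m0.
rewrite !lt_min => /andP[/andP[he he1] /andP[/andP[he2 h1] hB]].
have := H2 h he2; rewrite c0.
have := He (a + h); rewrite [a + h]addrC addrK -subr_eq0 addrK => /(_ h0 he) E.
have := HB h he1; rewrite [a + h]addrC => Bh.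
have {}E : g (h + a) = f (h + a) * h ^+ k by rewrite E mulfVK// expf_neq0.
have : nm (g (h + a)) <= B * nm h.
  rewrite E nmM nmX ler_pM ?nm_ge0 ?exprn_ge0 ?nm_ge0//.
  by rewrite -[leRHS]expr1 ler_wiXn2l ?nm_ge0// ltW.
move=> G1 G2; move: hB; rewrite ltr_pdivlMr => [hB|]; last by lra.
have := nmD (g a - g (h + a)) (g (h + a)); rewrite subrK nm_distC.
by have := nm_ge0 h; nra.
Qed.

End Poles.

(** A consequence of an equation up to a cofactor [l] becomes an identity for [ring] or [field]. *)
Lemma eq_of_multiple (K : nzRingType) (l a b p q : K) : a = b -> p - q = l * (a - b) -> p = q.
Proof. by move=> -> /eqP; rewrite subrr mulr0 subr_eq0 => /eqP. Qed.

Section LowCoefficients.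
Variable R : realType.
Implicit Types c d : nat -> Cx R.

Lemma conv0 c d : conv c d 0 = c 0%N * d 0%N.
Proof. by rewrite /conv big_ord1. Qed.

Lemma conv1 c d : conv c d 1 = c 0%N * d 1%N + c 1%N * d 0%N.
Proof. by rewrite /conv !big_ord_recl big_ord0 addr0. Qed.

Lemma conv2 c d : conv c d 2 = c 0%N * d 2%N + c 1%N * d 1%N + c 2%N * d 0%N.
Proof. by rewrite /conv !big_ord_recl big_ord0 addr0 addrA. Qed.

End LowCoefficients.

Section LocalData.
Variable R : realType.
Local Notation C := (Cx R).
Implicit Types (f g : C -> C) (c : nat -> C) (z : C).

Lemma near0_z (e : R) : 0 < e -> near0 (fun z : C => nm z < e).
Proof. by exists e. Qed.

Definition local_coefs (q : C -> C) (t0 : C) (al be de : C -> C) :=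
  near0 (fun z => z != 0 -> q (t0 + z) != 0 /\ exists dq,
    [/\ is_derive (t0 + z) 1 q dq, z * dq = (al z - 1) * q (t0 + z),
        z ^+ 2 * q (t0 + z) ^+ 2 = be z &
        z ^+ 2 * painleve2_u q (t0 + z) = de z * q (t0 + z) ^+ 2]).

(* Near a pole of order k >= 1 one has q = G z / z^k, and differentiating
   twice only involves the power series G, G', G''. *)
Lemma pole_quotient (q : C -> C) (t0 : C) : painleve2_solution q -> is_pole q t0 ->
  exists k G G' G'' c, [/\ (0 < k)%N, c 0%N != 0,
    [/\ hs G c, hs G' (derivS c) & hs G'' (derivS (derivS c))] &
    near0 (fun z => z != 0 -> [/\ q (t0 + z) = G z / z ^+ k,
       is_derive (t0 + z) 1 q ((z * G' z - k%:R * G z) / z ^+ k.+1) &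
       (z ^+ 2 * G'' z - 2 * k%:R * z * G' z + k%:R * k.+1%:R * G z) / z ^+ k.+2 =
       2 * q (t0 + z) ^+ 3 + (t0 + z) * q (t0 + z)])].
Proof.
move=> [qmero qeq] [k [g [k0 /analytic_hs[c Hc] g0 /near_punctP[e e0 He]]]].
pose G z := g (t0 + z).
have [G' [HG' DG]] := hs_deriv Hc; have [G'' [HG'' DG']] := hs_deriv HG'.
have c0 : c 0%N != 0 by rewrite -(hs0 Hc) addr0.
exists k, G, G', G'', c; split=> //.
have [r r0 Hr] := near0_and (near0_z e0) (near0_and DG DG').
have qE z : z != 0 -> nm z < r -> q (t0 + z) = G z / z ^+ k.
  move=> z0 /Hr[ze _]; rewrite He; first by rewrite [t0 + z]addrC addrK [z + t0]addrC.
    by rewrite -subr_eq0 [t0 + z]addrC addrK.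
  by rewrite [t0 + z]addrC addrK.
(* A small disc around z stays in the punctured disc, so the quotient formula can be differentiated
   there, and then once more. *)
have stay z : z != 0 -> nm z < r -> exists2 d : R, 0 < d &
    forall h, nm h < d -> z + h != 0 /\ nm (z + h) < r.
  move=> z0 zr; exists (Num.min (nm z) (r - nm z)); first by rewrite lt_min nm_gt0 z0 subr_gt0.
  move=> h; rewrite lt_min => /andP[hz hr]; split; last by have := nmD z h; lra.
  rewrite -nm_gt0; have := nmB (z + h) h; rewrite addrK.
  by lra.
pose Q1 z : C := (z * G' z - k%:R * G z) / z ^+ k.+1.
have D1 z : z != 0 -> nm z < r -> is_derive (t0 + z) 1 q (Q1 z).
  move=> z0 zr; have [d d0 Hd] := stay z z0 zr; apply/is_derive_shift1.
  apply: (@is_derive_near _ (fun z => G z / z ^+ k) _ _ _ d d0).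
    by move=> h /Hd[zh0 zhr]; rewrite qE.
  have [_ [DGz _]] := Hr z zr.
  have := is_derive_div DGz (is_derive_pow k (is_derive_id1 z)) (expf_neq0 k z0).
  congr is_derive; rewrite /Q1; case: k k0 {He qE Q1} => // k _ /=.
  rewrite !exprS; have zk := expf_neq0 k z0; move: zk.
  by rewrite -/(G z); set Z := z ^+ k => Z0; field; rewrite ?z0 ?Z0.
have D2 z : z != 0 -> nm z < r -> is_derive (t0 + z) 1 (derive1 q)
    ((z ^+ 2 * G'' z - 2 * k%:R * z * G' z + k%:R * k.+1%:R * G z) / z ^+ k.+2).
  move=> z0 zr; have [d d0 Hd] := stay z z0 zr; apply/is_derive_shift1.
  apply: (@is_derive_near _ Q1 _ _ _ d d0).
    by move=> h /Hd[zh0 zhr]; rewrite (derive1_val (D1 _ zh0 zhr)).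
  have [_ [DGz DGz']] := Hr z zr.
  have DN := is_derive_sub (is_derive_mul (is_derive_id1 z) DGz') (is_derive_scale k%:R DGz).
  have := is_derive_div DN (is_derive_pow k.+1 (is_derive_id1 z)) (expf_neq0 k.+1 z0).
  congr is_derive => /=; rewrite !exprS; have zk := expf_neq0 k z0; move: zk.
  by rewrite -/(G z) -!natr1; set Z := z ^+ k => Z0; field; rewrite ?z0 ?Z0.
exists r => // z zr z0; split; [exact: qE|exact: D1|].
have an : analytic_at q (t0 + z).
  by case: (qmero (t0 + z)) => // /(not_pole (D1 z z0 zr)).
by rewrite -(qeq _ an) -(derive1_val (D2 z z0 zr)).
Qed.

Lemma hs_near_val0 f g c d : hs f c -> hs g d ->
  near0 (fun z => z != 0 -> f z = g z) -> f 0 = g 0.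
Proof. by move=> Hf Hg H; rewrite (hs0 Hf) (hs0 Hg) (hs_coef_near Hf Hg H). Qed.

(** Dominant balance: a pole of order k gives order k + 2 for q'' and 3 k for q^3, so k = 1. The
    next coefficients are then read off from the equation multiplied by z^3. *)
Lemma simple_pole (q : C -> C) (t0 : C) : painleve2_solution q -> is_pole q t0 ->
  exists G G' c, [/\ hs G c, hs G' (derivS c),
    [/\ c 0%N ^+ 2 = 1, c 1%N = 0 & 6 * c 2%N = - t0 * c 0%N] &
    near0 (fun z => z != 0 -> q (t0 + z) = G z / z /\
       is_derive (t0 + z) 1 q ((z * G' z - G z) / z ^+ 2))].
Proof.
move=> hq ht0; have [k [G [G' [G'' [c [k0 c0 [HG HG' HG''] H]]]]]] := pole_quotient hq ht0.
have HG3 := hs_mul HG (hs_mul HG HG).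
have HtG := hs_add (hs_scale t0 HG) (hs_mulX HG).
have HL := hs_add (hs_sub (hs_mulX (hs_mulX HG'')) (hs_scale (2 * k%:R) (hs_mulX HG')))
  (hs_scale (k%:R * k.+1%:R) HG).
case: k k0 H HL => // -[_ H|k _ H] HL; last first.
  (* For order k + 2, multiplication by z^(3 k + 6) leaves a factor z^(2 k + 2) on the left, whereas
     the right side equals 2 G(0)^3 at 0. *)
  have HLL := hs_mul (hs_monom R (2 * k).+2) HL.
  have HRR := hs_add (hs_scale 2 HG3) (hs_mul (hs_monom R (2 * k).+4) HtG).
  exfalso; move: c0; rewrite -(hs0 HG) => /negP; apply.
  refine ((fun E => _) (hs_near_val0 HLL HRR _)); last first.
    apply: near0_sub H => z Hz z0; have [-> _] := Hz z0.
    have zk := expf_neq0 k z0.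
    have -> : z ^+ (2 * k).+2 = z * (z * (z ^+ k * z ^+ k)).
      by rewrite mul2n -addnn !exprS exprD.
    have -> : z ^+ (2 * k).+4 = z * (z * (z * (z * (z ^+ k * z ^+ k)))).
      by rewrite mul2n -addnn !exprS exprD.
    have -> : z ^+ k.+4 = z * (z * (z * (z * z ^+ k))) by rewrite !exprS.
    have -> : z ^+ k.+2 = z * (z * z ^+ k) by rewrite !exprS.
    move: zk; set Z := z ^+ k => Z0 F.
    apply: (eq_of_multiple (l := (z * (z * Z)) ^+ 3) F).
    by field; rewrite z0 Z0.
  have /eqP : 2 * (G 0 * (G 0 * G 0)) = 0.
    by move: E; rewrite !expr0n /= !mul0r addr0.
  by rewrite !mulf_eq0 pnatr_eq0 /=; case: (G 0 == 0).
have HR := hs_add (hs_scale 2 HG3) (hs_mulX (hs_mulX HtG)).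
exists G, G', c; split=> //; last first.
  apply: near0_sub H => z Hz /Hz[-> D _]; rewrite expr1; split=> //.
  by move: D; rewrite mul1r.
refine ((fun E => _) (hs_coef_near HL HR _)); last first.
  apply: near0_sub H => z Hz z0; have [-> _ F] := Hz z0.
  apply: (eq_of_multiple (l := z ^+ 3) F).
  by field; rewrite z0.
(* The coefficient of z^n on the left is (n - 1)(n - 2) [c n], so the orders 1 and 2 constrain the
   right side alone. *)
have E0 := congr1 (fun d => d 0%N) E; have E1 := congr1 (fun d => d 1%N) E.
have E2 := congr1 (fun d => d 2%N) E; move: E0 E1 E2.
rewrite !(conv0, conv1, conv2) /derivS /= => E0 E1 E2.
have cc : c 0%N ^+ 2 = 1.
  by apply: (mulfI c0); apply: (eq_of_multiple (l := - 2^-1) E0); field.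
have c10 : c 1%N = 0.
  rewrite -[LHS]mul1r -cc.
  by apply: (eq_of_multiple (l := - 6^-1) E1); field.
split=> //; rewrite c10 in E2.
have -> : c 2%N = c 0%N ^+ 2 * c 2%N by rewrite cc mul1r.
by apply: (eq_of_multiple (l := -1) E2); ring.
Qed.

Lemma pole_local_coefs (q : C -> C) (t0 : C) : painleve2_solution q -> is_pole q t0 ->
  exists (al be de : C -> C) (a b d : nat -> C),
  [/\ [/\ hs al a, hs be b & hs de d], [/\ a 0%N = 0 & a 1%N = 0],
    [/\ b 0%N = 1 & b 1%N = 0], [/\ d 0%N = 0, d 1%N = 0 & d 2%N = 0] &
    local_coefs q t0 al be de].
Proof.
move=> hq ht0; have [G [G' [c [HG HG' [cc c10 c2E] H]]]] := simple_pole hq ht0.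
have c0 : c 0%N != 0 by apply: contra_eq_neq cc => ->; rewrite expr0n eq_sym oner_eq0.
have [v Hv] := hs_inv HG c0.
have HW := hs_sub (hs_mulX HG') HG.
have HGG := hs_mul HG HG.
have HP := hs_sub (hs_sub (hs_mul HW HW)
  (hs_add (hs_scale t0 (hs_mulX (hs_mulX HGG))) (hs_mulX (hs_mulX (hs_mulX HGG)))))
  (hs_mul HGG HGG).
move: HP; set p := (X in hs _ X) => HP.
have p0 : p 0%N = 0.
  rewrite /p !conv0 /=.
  by apply: (eq_of_multiple (l := - c 0%N ^+ 2) cc); ring.
have p1 : p 1%N = 0 by rewrite /p !(conv1, conv0) /derivS /= c10; ring.
(* [p] is the series of z^4 u. Its z^2 coefficient cancels precisely because of the t0 term in the
   expansion of q. *)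
have p2 : p 2%N = 0.
  rewrite /p !(conv2, conv1, conv0) /derivS /= c10.
  transitivity (- c 0%N * (6 * c 2%N - - t0 * c 0%N) -
    4 * c 0%N * c 2%N * (c 0%N ^+ 2 - 1)); first by ring.
  by rewrite c2E cc; ring.
exists (fun z => z * G' z * (G z)^-1), (fun z => G z * G z),
  (fun z => ((z * G' z - G z) * (z * G' z - G z) -
    (t0 * (z * (z * (G z * G z))) + z * (z * (z * (G z * G z)))) -
    G z * G z * (G z * G z)) * ((G z)^-1 * (G z)^-1)).
exists (conv (fun n => if n is m.+1 then derivS c m else 0) v), (conv c c).
eexists; split.
- split=> //; [exact: hs_mul (hs_mulX HG') Hv|exact: hs_mul HP (hs_mul Hv Hv)].
- by rewrite conv0 conv1 /derivS c10; split; ring.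
- by rewrite conv0 conv1 c10 -expr2 cc; split; ring.
- by rewrite conv2 conv1 conv0 p0 p1 p2 !mul0r !addr0.
apply: near0_sub (near0_and H (hs_neq0 HG c0)) => z [Hz Gz] z0.
have [qE D] := Hz z0; split; first by rewrite qE mulf_neq0 ?invr_eq0.
exists ((z * G' z - G z) / z ^+ 2); split=> //.
- by rewrite qE; field; rewrite z0 Gz.
- by rewrite qE; field.
- by rewrite /painleve2_u (derive1_val D) qE; field; rewrite z0 Gz.
Qed.

End LocalData.

(** * The slit disc and the cubic root *)

Section SlitDisc.
Variable R : realType.
Local Notation C := (Cx R).
Implicit Types (f : C -> C) (z : C).
Variable w : C.
Hypothesis w0 : w != 0.

Lemma complex_ge0E (x : C) : (0 <= x) = (complex.Im x == 0) && (0 <= complex.Re x).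
Proof. exact: lecE. Qed.

Lemma ReD (x y : C) : complex.Re (x + y) = complex.Re x + complex.Re y.
Proof. by case: x; case: y. Qed.
Lemma ImD (x y : C) : complex.Im (x + y) = complex.Im x + complex.Im y.
Proof. by case: x; case: y. Qed.
Lemma ReZ (s : R) (x : C) : complex.Re (inC s * x) = s * complex.Re x.
Proof. by case: x => a b; rewrite /= mul0r subr0. Qed.
Lemma ImZ (s : R) (x : C) : complex.Im (inC s * x) = s * complex.Im x.
Proof. by case: x => a b; rewrite /= mul0r addr0. Qed.

(** Division by w turns the slit into the nonnegative real half-line. *)
Lemma slit_discE (e : R) z : slit_disc w (inC e) z <->
  nm z < e /\ (complex.Im (z / w) != 0 \/ complex.Re (z / w) < 0).
Proof.
rewrite /slit_disc /= norm_lt; split=> -[ze H]; split=> //.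
  apply/orP; rewrite ltNge -negb_and -complex_ge0E.
  by apply/negP => /H; rewrite divfK// eqxx.
move=> x x0; apply/eqP => zE; move: H; rewrite zE mulfK// => H.
by move: x0; rewrite complex_ge0E => /andP[/eqP I0 R0]; case: H; [rewrite I0 eqxx|lra].
Qed.

Lemma slit_neq0 e z : slit_disc w e z -> z != 0.
Proof. by move=> [_ /(_ 0 (lexx _))]; rewrite mul0r. Qed.

Lemma slit_sub (e e' : C) z : e <= e' -> slit_disc w e z -> slit_disc w e' z.
Proof. by move=> ee [ze H]; split=> //; apply: lt_le_trans ee. Qed.

Lemma slit_open (e : R) z : slit_disc w (inC e) z ->
  exists2 d : R, 0 < d & forall h, nm h < d -> slit_disc w (inC e) (z + h).
Proof.
move=> /slit_discE[ze H]; have nw : 0 < nm w by rewrite nm_gt0.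
have small d h : nm h < nm w * d -> `|complex.Re (h / w)| < d /\ `|complex.Im (h / w)| < d.
  move=> hd; have [] := ReIm_le (h / w); rewrite nmM nmV => H1 H2.
  have hw : nm h / nm w < d by rewrite ltr_pdivrMr// mulrC.
  by split; apply: le_lt_trans hw.
(* The margin by which z / w avoids the half-line, through its imaginary part if that is nonzero and
   through its real part otherwise. *)
pose m := if complex.Im (z / w) != 0 then `|complex.Im (z / w)| else - complex.Re (z / w).
have m0 : 0 < m.
  rewrite /m; case: ifPn => [|/negPn/eqP I0]; first by rewrite normr_gt0.
  by case: H; [rewrite I0 eqxx|lra].
exists (Num.min (e - nm z) (nm w * m)); first by rewrite lt_min subr_gt0 ze mulr_gt0.
move=> h; rewrite lt_min => /andP[he /small[hR hI]]; apply/slit_discE; split.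
  by have := nmD z h; lra.
rewrite mulrDl ReD ImD; move: hR hI; rewrite /m.
case: ifPn => [I0 _ hI|I0 hR _].
  left; apply/eqP => E; move: hI; rewrite (_ : complex.Im (h / w) = - complex.Im (z / w)).
    by rewrite normrN ltxx.
  by lra.
by right; have := ler_norm (complex.Re (h / w)); lra.
Qed.

Lemma ray_in_slit (e x : R) : 0 < x -> x * nm w < e -> slit_disc w (inC e) (- (inC x * w)).
Proof.
move=> x0 xe; apply/slit_discE; rewrite nmN nmM nm_inC gtr0_norm//; split=> //.
by right; rewrite mulNr mulfK//= oppr_lt0.
Qed.

Lemma exists_in_slit (e d : R) : 0 < e -> 0 < d -> exists x : R,
  [/\ 0 < x, slit_disc w (inC e) (- (inC x * w)) & nm (- (inC x * w)) < d].
Proof.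
move=> e0 d0; have nw : 0 < nm w by rewrite nm_gt0.
pose m := Num.min e d; have m0 : 0 < m by rewrite lt_min e0.
have m1 : m / 2 < m by lra.
have x0 : 0 < m / 2 / nm w by rewrite !divr_gt0.
have xw : m / 2 / nm w * nm w = m / 2 by rewrite mulfVK// gt_eqF.
exists (m / 2 / nm w); split=> //.
  by apply: ray_in_slit => //; rewrite xw (lt_le_trans m1)// /m ge_min lexx.
rewrite nmN nmM nm_inC gtr0_norm// xw (lt_le_trans m1)//.
by rewrite /m ge_min lexx orbT.
Qed.

(** In the coordinate z / w the centre is the negative real -x. Along the segment the imaginary part
    is scaled by s; if it vanishes, the real part is a convex combination of two negative
    numbers. *)
Lemma slit_star (e x s : R) z : 0 < x -> x * nm w < e -> slit_disc w (inC e) z ->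
  0 <= s <= 1 -> slit_disc w (inC e) (- (inC x * w) + inC s * (z - - (inC x * w))).
Proof.
move=> x0 xe /slit_discE[ze H] /andP[s0 s1]; apply/slit_discE.
have -> : - (inC x * w) + inC s * (z - - (inC x * w)) =
    inC (- ((1 - s) * x)) * w + inC s * z.
  rewrite (_ : inC (- ((1 - s) * x)) = - ((1 - inC s) * inC x)); first by ring.
  rewrite /inC rmorphN rmorphM rmorphB rmorph1.
  by [].
split.
  apply: le_lt_trans (nmD _ _) _; rewrite !nmM !nm_inC normrN !ger0_norm ?mulr_ge0//; try lra.
  have [->|sn0] := eqVneq s 0; first by rewrite mul0r subr0 mul1r addr0.
  have P1 : 0 < s * (e - nm z) by rewrite mulr_gt0 ?subr_gt0// lt_def sn0.
  have P2 : 0 <= (1 - s) * (e - x * nm w) by rewrite mulr_ge0 ?subr_ge0 ?(ltW xe).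
  by lra.
rewrite mulrDl mulfK// ReD ImD -mulrA ReZ ImZ /= add0r.
have [->|sn0] := eqVneq s 0; first by right; rewrite !mul0r; lra.
have {}s0 : 0 < s by rewrite lt_def sn0.
case: H => H; [left|right]; first by rewrite mulf_neq0.
by nra.
Qed.

Lemma real_zero_derivative_cst (g : R -> R) :
  (forall s : R, 0 <= s <= 1 -> forall e : R, 0 < e -> exists2 d : R, 0 < d &
    forall h : R, `|h| < d -> `|g (s + h) - g s| <= e * `|h|) -> g 0 = g 1.
Proof.
move=> H.
have D (s : R) : 0 <= s <= 1 -> is_derive s 1 g 0.
  move=> s01; have K : h^-1 *: ((g \o shift s) (h *: 1) - g s) @[h --> 0^'] --> (0 : R).
    apply/cvgrPdist_lt => e e0; have [d d0 Hd] := H s s01 (e / 2) (divr_gt0 e0 (ltr0Sn _ 1)).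
    near=> h; rewrite sub0r normrN /= normrM normfV.
    have h0 : h != 0 by near: h; exact: nbhs_dnbhs_neq.
    have hd : `|h| < d by near: h; apply: dnbhs0_lt.
    rewrite mulrC ltr_pdivrMr ?normr_gt0// {1}/GRing.scale /= mulr1 [h + s]addrC.
    apply: le_lt_trans (Hd h hd) _; rewrite ltr_pM2r ?normr_gt0//.
    by lra.
  split; first by apply/cvg_ex; exists 0.
  exact: cvg_lim K.
have [||c _] := @MVT_segment R g (fun=> 0) 0 1 ler01; last by rewrite mul0r => /eqP; rewrite subr_eq0 => /eqP.
  by move=> x; rewrite in_itv /= => /andP[x0 x1]; apply: D; rewrite !ltW.
apply: continuous_in_subspaceT => x; rewrite inE /= in_itv /= => x01.
apply/differentiable_continuous/derivable1_diffP.
by case: (D x x01).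
Unshelve. all: by end_near.
Qed.

(** Both points are joined by segments to a common centre of the star. The mean value theorem fails
    for complex values, so it is applied to real and imaginary parts. *)
Lemma zero_derivative_cst f (t0 : C) (e : R) z1 z2 :
  (forall z, slit_disc w (inC e) z -> is_derive (t0 + z) 1 f 0) ->
  slit_disc w (inC e) z1 -> slit_disc w (inC e) z2 -> f (t0 + z1) = f (t0 + z2).
Proof.
move=> H s1 s2.
have e0 : 0 < e by have /slit_discE[ze _] := s1; exact: le_lt_trans (nm_ge0 _) ze.
have [x [x0 xs _]] := exists_in_slit e0 ltr01.
have xe : x * nm w < e by have /slit_discE[] := xs; rewrite nmN nmM nm_inC gtr0_norm.
pose c : C := - (inC x * w).
suff K z : slit_disc w (inC e) z -> f (t0 + c) = f (t0 + z) by rewrite -K// -K.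
move=> sz; pose ga (s : R) : C := t0 + (c + inC s * (z - c)).
(* [P] stands for the real or the imaginary part: compatible with subtraction and not exceeding the
   modulus. *)
have DD (P : C -> R) : (forall u v : C, P (u - v) = P u - P v) ->
    (forall u : C, `|P u| <= nm u) -> P (f (t0 + c)) = P (f (t0 + z)).
  move=> PB Ple; have := @real_zero_derivative_cst (fun s => P (f (ga s))).
  rewrite /ga inC0 inC1 mul0r addr0 mul1r [c + (z - c)]addrC subrK; apply.
  move=> s s01 a a0; have := H _ (slit_star x0 xe sz s01).
  move=> /is_deriveP /(_ (a / (nm (z - c) + 1))) [|d d0 Hd].
    by rewrite divr_gt0//; have := nm_ge0 (z - c); lra.
  have nz : 0 < nm (z - c) + 1 by have := nm_ge0 (z - c); lra.
  exists (d / (nm (z - c) + 1)); first by rewrite divr_gt0.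
  move=> h hd; rewrite -PB; apply: le_trans (Ple _) _.
  have hz : nm (inC h * (z - c)) < d.
    rewrite nmM nm_inC; move: hd; rewrite ltr_pdivlMr//.
    by have := normr_ge0 h; nra.
  have := Hd _ hz; rewrite mulr0 subr0.
  rewrite (_ : t0 + _ + _ = t0 + (c + inC (s + h) * (z - c))); last first.
    by rewrite inCD /c; ring.
  move=> /le_trans; apply; rewrite nmM nm_inC mulrCA [leRHS]mulrC ler_wpM2l//.
  by rewrite mulrAC ler_pdivrMr// ler_wpM2l ?ltW// ltrDl.
have := DD (@complex.Re R) _ _; have := DD (@complex.Im R) _ _.
case: (f (t0 + c)) => a b; case: (f (t0 + z)) => a' b' /= -> //.
- by move=> -> //; [move=> [? ?] [? ?]|move=> u; case: (ReIm_le u)].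
- by move=> [? ?] [? ?].
- by move=> u; case: (ReIm_le u).
Qed.

Variables (rho : C) (r : C -> C).
Hypotheses (rho0 : 0 < rho) (hr : cbrt_branch w rho r).

Lemma branch_neq0 z : slit_disc w rho z -> r z != 0.
Proof.
move=> sz; have [_ rz] := hr sz; apply: contra_eq_neq rz => ->.
by rewrite expr0n /= eq_sym (slit_neq0 sz).
Qed.

(** Only continuity and r^3 = z are known. With a = r z and k the increment of r, h = k (3 a^2 + 3 a
    k + k^2), so for small k the increment k is bounded by h / a^2 in modulus and the error is
    quadratic in k. *)
Lemma branch_deriv z : slit_disc w rho z -> is_derive z 1 r (3 * r z ^+ 2)^-1.
Proof.
have [p p0 rhoE] := gt0_inC rho0.
move=> sz; have [/continuousP cr rz] := hr sz; have a0 := branch_neq0 sz.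
have sz' := sz; rewrite rhoE in sz'; have [d d0 Hd] := slit_open sz'; rewrite -rhoE in Hd.
apply/is_deriveP => e e0; set a := r z in a0 rz cr *.
have na : 0 < nm a by rewrite nm_gt0.
have [|d' d'0 Hd'] := cr (Num.min (nm a / 2) (e * nm a ^+ 3 / 2)).
  by rewrite lt_min !divr_gt0// mulr_gt0// exprn_gt0.
exists (Num.min d d'); first by rewrite lt_min d0.
move=> h; rewrite lt_min => /andP[/Hd sh /Hd'].
have [_ rzh] := hr sh; set k := r (z + h) - a.
rewrite lt_min => /andP[k1 k2].
have hE : h = k * (3 * a ^+ 2 + 3 * a * k + k ^+ 2).
  have -> : h = r (z + h) ^+ 3 - a ^+ 3 by rewrite rzh rz addrC addKr.
  by rewrite /k; ring.
have DE : k - h * (3 * a ^+ 2)^-1 = - (k * (k * (3 * a + k))) * (3 * a ^+ 2)^-1.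
  by rewrite {1}hE; field.
have n3 : nm (3 * a) = 3 * nm a by rewrite nmM (nm_nat _ 3).
have nk := nm_ge0 k.
have hge : nm k * nm a ^+ 2 <= nm h.
  rewrite [in leRHS]hE nmM ler_wpM2l//.
  have := nmB (3 * a ^+ 2 + 3 * a * k + k ^+ 2) (3 * a * k + k ^+ 2).
  rewrite (_ : _ - _ = 3 * a ^+ 2); last by ring.
  have := nmD (3 * a * k) (k ^+ 2).
  by rewrite ![nm (3 * _)]nmM [nm (3 * a * k)]nmM n3 (nm_nat _ 3) !nmX; nra.
rewrite -/k DE nmM nmN nmV [nm (3 * _)]nmM (nm_nat _ 3) nmX.
rewrite ler_pdivrMr; last by rewrite mulr_gt0// exprn_gt0.
rewrite !nmM.
have B1 : nm (3 * a + k) <= 4 * nm a by have := nmD (3 * a) k; rewrite n3; lra.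
have P1 : nm k * (nm k * nm (3 * a + k)) <= nm k * (e * nm a ^+ 3 / 2 * (4 * nm a)).
  by rewrite ler_wpM2l// ler_pM ?nm_ge0// ltW.
apply: le_trans P1 _.
have : e * (nm k * nm a ^+ 2) * (3 * nm a ^+ 2) <= e * nm h * (3 * nm a ^+ 2).
  by rewrite ler_wpM2r ?ler_wpM2l ?(ltW e0)// mulr_ge0// exprn_ge0// ltW.
apply: le_trans; rewrite -subr_ge0.
have -> : e * (nm k * nm a ^+ 2) * (3 * nm a ^+ 2) - nm k * (e * nm a ^+ 3 / 2 * (4 * nm a)) =
  e * nm k * nm a ^+ 4 by field.
by rewrite !mulr_ge0 ?exprn_ge0 ?(ltW e0) ?(ltW na).
Qed.

End SlitDisc.

(** * The linear system on the slit disc *)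

Section FundamentalSystem.
Variable R : realType.
Local Notation C := (Cx R).
Implicit Types (z : C) (y : unknown -> C -> C) (v : unknown -> nat -> C)
  (F : unknown -> C -> C).

Variables (q : C -> C) (t0 : C) (w rho : C) (r : C -> C) (al be de : C -> C).

(** The system divided by q^2 and multiplied by z, or by z^2 in the last equation; it uses (q^2)' /
    q^2 = 2 (al - 1) / z. *)
Definition reduced_system z (Y dY : unknown -> C) :=
  [/\ 3 * z * dY MuPlus = 2 * (al z - 1) * Y MuPlus - z * Y Nu,
      3 * z * dY MuMinus = - (2 * (al z - 1) * Y MuMinus) + z * Y Nu &
      3 * z ^+ 2 * dY Nu = 2 * be z * Y MuMinus - 2 * de z * Y MuPlus].

Definition reduced_solution (e : R) y := forall z, slit_disc w (inC e) z ->
  exists2 dY, forall x, is_derive (t0 + z) 1 (y x) (dY x) &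
    reduced_system z (fun x => y x (t0 + z)) dY.

Lemma reduced_solutionP (e : R) y :
  (forall z, nm z < e -> z != 0 -> q (t0 + z) != 0 /\ exists dq,
    [/\ is_derive (t0 + z) 1 q dq, z * dq = (al z - 1) * q (t0 + z),
        z ^+ 2 * q (t0 + z) ^+ 2 = be z &
        z ^+ 2 * painleve2_u q (t0 + z) = de z * q (t0 + z) ^+ 2]) ->
  solves_system_on [set t0 + z | z in slit_disc w (inC e)] q y <->
  reduced_solution e y.
Proof.
move=> L; have K z : slit_disc w (inC e) z -> [/\ z != 0, q (t0 + z) != 0 &
    [/\ derive1 (fun s => q s ^+ 2) (t0 + z) = 2 * (al z - 1) * q (t0 + z) ^+ 2 / z,
        z ^+ 2 * q (t0 + z) ^+ 2 = be z &
        painleve2_u q (t0 + z) = de z * q (t0 + z) ^+ 2 / z ^+ 2]].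
  move=> sz; have z0 := slit_neq0 sz; have [ze _] := sz; rewrite norm_lt in ze.
  have [q0 [dq [D dqE beE uE]]] := L z ze z0; split=> //; split=> //.
    rewrite (derive1_val (is_derive_pow 2 D)) /= expr1.
    by apply: (eq_of_multiple (l := 2 * q (t0 + z) / z) dqE); field.
  by apply: (eq_of_multiple (l := (z ^+ 2)^-1) uE); field.
split=> [H z sz|H]; last move=> /= _ [z sz <-].
  have [z0 q0 [q2 beE uE]] := K z sz.
  have [D E1 E2 E3] := H (t0 + z) (ex_intro2 _ _ z sz erefl).
  exists (fun x => derive1 (y x) (t0 + z)); first by move=> x; exact: derivable1_derive1.
  rewrite q2 in E1 E2; rewrite uE in E3; split.
  - by apply: (eq_of_multiple (l := z / q (t0 + z) ^+ 2) E1); field; rewrite z0 q0.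
  - by apply: (eq_of_multiple (l := z / q (t0 + z) ^+ 2) E2); field; rewrite z0 q0.
  - rewrite -beE.
    by apply: (eq_of_multiple (l := z ^+ 2 / q (t0 + z) ^+ 2) E3); field; rewrite z0 q0.
have [z0 q0 [q2 beE uE]] := K z sz.
have [dY D [E1 E2 E3]] := H z sz; rewrite q2 uE !(derive1_val (D _)); split.
- by move=> x; case: (D x).
- by apply: (eq_of_multiple (l := q (t0 + z) ^+ 2 / z) E1); field.
- by apply: (eq_of_multiple (l := q (t0 + z) ^+ 2 / z) E2); field.
- rewrite -beE in E3.
  by apply: (eq_of_multiple (l := q (t0 + z) ^+ 2 / z ^+ 2) E3); field.
Qed.

Lemma reduced_solution_sub (e e' : R) y : e' <= e -> reduced_solution e y -> reduced_solution e' y.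
Proof. by move=> ee H z /(slit_sub _) sz; apply: H; apply: sz; rewrite inC_le. Qed.

Lemma reduced_solution_comb (e : R) (c0 c1 c2 : C) y0 y1 y2 :
  reduced_solution e y0 -> reduced_solution e y1 -> reduced_solution e y2 ->
  reduced_solution e (fun x t => c0 * y0 x t + c1 * y1 x t + c2 * y2 x t).
Proof.
move=> H0 H1 H2 z sz; have [d0 D0 [A0 B0 E0]] := H0 z sz.
have [d1 D1 [A1 B1 E1]] := H1 z sz; have [d2 D2 [A2 B2 E2]] := H2 z sz.
exists (fun x => c0 * d0 x + c1 * d1 x + c2 * d2 x).
  move=> x; have := is_deriveD (is_deriveD (is_derive_scale c0 (D0 x))
    (is_derive_scale c1 (D1 x))) (is_derive_scale c2 (D2 x)).
  exact.
split.
- transitivity (c0 * (3 * z * d0 MuPlus) + c1 * (3 * z * d1 MuPlus) + c2 * (3 * z * d2 MuPlus)).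
    by ring.
  by rewrite A0 A1 A2; ring.
- transitivity (c0 * (3 * z * d0 MuMinus) + c1 * (3 * z * d1 MuMinus) + c2 * (3 * z * d2 MuMinus)).
    by ring.
  by rewrite B0 B1 B2; ring.
- transitivity (c0 * (3 * z ^+ 2 * d0 Nu) + c1 * (3 * z ^+ 2 * d1 Nu) + c2 * (3 * z ^+ 2 * d2 Nu)).
    by ring.
  by rewrite E0 E1 E2; ring.
Qed.

Definition det3 (X Y Z : unknown -> C) : C :=
  X MuPlus * (Y MuMinus * Z Nu - Y Nu * Z MuMinus)
  - Y MuPlus * (X MuMinus * Z Nu - X Nu * Z MuMinus)
  + Z MuPlus * (X MuMinus * Y Nu - X Nu * Y MuMinus).

(* The system is traceless, so the Wronskian-type determinant is constant. *)
Lemma det3_const (e : R) y0 y1 y2 z z' : w != 0 ->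
  reduced_solution e y0 -> reduced_solution e y1 -> reduced_solution e y2 ->
  slit_disc w (inC e) z -> slit_disc w (inC e) z' ->
  det3 (y0^~ (t0 + z)) (y1^~ (t0 + z)) (y2^~ (t0 + z)) =
  det3 (y0^~ (t0 + z')) (y1^~ (t0 + z')) (y2^~ (t0 + z')).
Proof.
move=> w0 H0 H1 H2 sz sz'.
apply: (@zero_derivative_cst R w w0 (fun t => det3 (y0^~ t) (y1^~ t) (y2^~ t)) t0 e z z') => // {z' sz'}.
move=> {sz} {}z sz; have [d0 D0 [A0 B0 E0]] := H0 z sz.
have [d1 D1 [A1 B1 E1]] := H1 z sz; have [d2 D2 [A2 B2 E2]] := H2 z sz.
have z0 := slit_neq0 sz.
have M2 := fun x x' (ya yb : unknown -> C -> C) da db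
  (Da : forall x, is_derive (t0 + z) 1 (ya x) (da x))
  (Db : forall x, is_derive (t0 + z) 1 (yb x) (db x)) =>
  is_derive_sub (is_derive_mul (Da x) (Db x')) (is_derive_mul (Da x') (Db x)).
have D := is_deriveD (is_derive_sub
  (is_derive_mul (D0 MuPlus) (M2 MuMinus Nu _ _ _ _ D1 D2))
  (is_derive_mul (D1 MuPlus) (M2 MuMinus Nu _ _ _ _ D0 D2)))
  (is_derive_mul (D2 MuPlus) (M2 MuMinus Nu _ _ _ _ D0 D1)).
have sol (d Y : C) l : l != 0 -> l * d = Y -> d = Y / l by move=> l0 <-; rewrite mulrAC divff ?mul1r.
have z3 : 3 * z != 0 by rewrite mulf_neq0// pnatr_eq0.
have zz3 : 3 * z ^+ 2 != 0 by rewrite mulf_neq0 ?expf_neq0// pnatr_eq0.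
move: D; rewrite (sol _ _ _ z3 A0) (sol _ _ _ z3 A1) (sol _ _ _ z3 A2).
rewrite (sol _ _ _ z3 B0) (sol _ _ _ z3 B1) (sol _ _ _ z3 B2).
rewrite (sol _ _ _ zz3 E0) (sol _ _ _ zz3 E1) (sol _ _ _ zz3 E2).
congr is_derive.
by field.
Qed.

(** Cramer's rule without division is a polynomial identity. *)
Lemma cramer3 (X Y Z V : unknown -> C) x :
  det3 X Y Z * V x = det3 V Y Z * X x + det3 X V Z * Y x + det3 X Y V * Z x.
Proof. by rewrite /det3; case: x; ring. Qed.

(* r z ^- 2 is z^(-2/3). *)
Definition frac_solution F x t : C := let z := t - t0 in
  r z ^- 2 * F x z * (if x is Nu then z^-1 else 1).

Lemma frac_solutionE F x z : frac_solution F x (t0 + z) =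
  r z ^- 2 * F x z * (if x is Nu then z^-1 else 1).
Proof. by rewrite /frac_solution [t0 + z]addrC addrK. Qed.

Variables (a b d : nat -> C).
Hypotheses (w0 : w != 0) (rho0 : 0 < rho) (hr : cbrt_branch w rho r).
Hypotheses (Hal : hs al a) (Hbe : hs be b) (Hde : hs de d).

(** Since z f' has coefficients n [c n], the recurrences say that two functions have the same
    series, hence agree near 0. The prefactors z^(-2/3) and z^(-5/3) supply the remaining
    constants. *)
Lemma formal_solution_sound v F : formal_solution a b d v ->
  (forall x, hs (F x) (v x)) ->
  exists2 e : R, 0 < e & reduced_solution e (frac_solution F).
Proof.
move=> Hv HF.
have [FK [HK DK]] := hs_deriv (HF MuPlus); have [FM [HM DM]] := hs_deriv (HF MuMinus).
have [FS [HS DS]] := hs_deriv (HF Nu).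
have zder c n : (if n is m.+1 then derivS c m else 0) = n%:R * c n :> C.
  by case: n => [|n]; rewrite ?mul0r.
have N1 : near0 (fun z => 3 * (z * FK z) = 2 * (al z * F MuPlus z) - F Nu z).
  have := hs_sub (hs_scale 2 (hs_mul Hal (HF MuPlus))) (HF Nu).
  apply: hs_uniq; have := hs_scale 3 (hs_mulX HK); congr hs.
  by apply/funext => n; have [E _ _] := Hv n; rewrite zder mulrA.
have N2 : near0 (fun z => 3 * (z * FM z) - 4 * F MuMinus z =
    - 2 * (al z * F MuMinus z) + F Nu z).
  have := hs_add (hs_scale (- 2) (hs_mul Hal (HF MuMinus))) (HF Nu).
  apply: hs_uniq; have := hs_sub (hs_scale 3 (hs_mulX HM)) (hs_scale 4 (HF MuMinus)).
  congr hs; apply/funext => n; have [_ E _] := Hv n.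
  by rewrite zder -E; ring.
have N3 : near0 (fun z => 3 * (z * FS z) - 5 * F Nu z =
    2 * (be z * F MuMinus z) - 2 * (de z * F MuPlus z)).
  have := hs_sub (hs_scale 2 (hs_mul Hbe (HF MuMinus))) (hs_scale 2 (hs_mul Hde (HF MuPlus))).
  apply: hs_uniq; have := hs_sub (hs_scale 3 (hs_mulX HS)) (hs_scale 5 (HF Nu)).
  congr hs; apply/funext => n; have [_ _ E] := Hv n.
  by rewrite zder -E; ring.
have [p p0 rhoE] := gt0_inC rho0.
have [e e0 He] := near0_and (near0_z p0) (near0_and (near0_and DK (near0_and DM DS))
  (near0_and N1 (near0_and N2 N3))).
exists e => // z sz; have [ze _] := sz; rewrite norm_lt in ze.
have z0 := slit_neq0 sz.
have [zp [[{}DK [{}DM {}DS]] [{}N1 [{}N2 {}N3]]]] := He z ze.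
have sp : slit_disc w rho z by case: sz => _ H; split=> //; rewrite rhoE norm_lt.
have r0 := branch_neq0 hr sp; have Dr := branch_deriv w0 rho0 hr sp.
have rz : r z ^+ 3 = z by case: (hr sp).
have Dq (f : C -> C) df : is_derive z 1 f df ->
    is_derive z 1 (fun z => r z ^- 2 * f z) (r z ^- 2 * (df - 2 / 3 * f z / z)).
  move=> Df; have := is_derive_div Df (is_derive_pow 2 Dr) (expf_neq0 2 r0).
  rewrite (_ : (fun z => r z ^- 2 * f z) = (fun z => f z / r z ^+ 2)); last first.
    by apply/funext => s; rewrite mulrC.
  congr is_derive; move: rz r0; set s := r z => <- s0.
  by field; rewrite s0.
exists (fun x => match x with
  | MuPlus => r z ^- 2 * (FK z - 2 / 3 * F MuPlus z / z)
  | MuMinus => r z ^- 2 * (FM z - 2 / 3 * F MuMinus z / z)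
  | Nu => r z ^- 2 * (FS z - 5 / 3 * F Nu z / z) / z end).
  move=> x; apply/is_derive_shift1.
  rewrite (_ : (fun z => frac_solution F x (t0 + z)) =
    (fun z => r z ^- 2 * F x z * (if x is Nu then z^-1 else 1))); last first.
    by apply/funext => s; rewrite frac_solutionE.
  case: x.
  - rewrite (_ : (fun z => _ * 1) = (fun z => r z ^- 2 * F MuPlus z)); first exact: Dq.
    by apply/funext => s; rewrite mulr1.
  - rewrite (_ : (fun z => _ * 1) = (fun z => r z ^- 2 * F MuMinus z)); first exact: Dq.
    by apply/funext => s; rewrite mulr1.
  - have := is_derive_div (Dq _ _ DS) (is_derive_id1 z) z0.
    by congr is_derive; field; rewrite z0 r0.
rewrite /reduced_system !frac_solutionE; split.
- by apply: (eq_of_multiple (l := r z ^- 2) N1); field; rewrite z0 r0.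
- by apply: (eq_of_multiple (l := r z ^- 2) N2); field; rewrite z0 r0.
- by apply: (eq_of_multiple (l := r z ^- 2) N3); field; rewrite z0 r0.
Qed.

(** Factoring z out of the second column and z^2 out of the third leaves the value 1 * (1 * 2 - (-1)
    * 1) = 3 at 0; the other minors contain the last two entries of the first column, which vanish
    there. *)
Lemma det3_neq0 v0 v1 v2 F0 F1 F2 :
  (forall x, hs (F0 x) (v0 x)) -> (forall x, hs (F1 x) (v1 x)) -> (forall x, hs (F2 x) (v2 x)) ->
  v0 MuPlus 0%N = 1 -> v0 MuMinus 0%N = 0 -> v0 Nu 0%N = 0 ->
  (forall x, v1 x 0%N = 0) -> v1 MuMinus 1%N = 1 -> v1 Nu 1%N = - 1 ->
  (forall x, v2 x 0%N = 0) -> (forall x, v2 x 1%N = 0) ->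
  v2 MuMinus 2%N = 1 -> v2 Nu 2%N = 2 ->
  near0 (fun z => z != 0 -> det3 (F0^~ z) (F1^~ z) (F2^~ z) != 0).
Proof.
move=> H0 H1 H2 v0K v0M v0S v10 v1M v1S v20 v21 v2M v2S.
have sh F v : (forall x, hs (F x) (v x)) -> exists2 G : unknown -> C -> C,
    forall x, hs (G x) (shiftS (v x)) &
    near0 (fun z => forall x, F x z = v x 0%N + z * G x z).
  move=> HF; have [G HG] := choice (fun x => hs_shift (HF x)).
  exists G; first by move=> x; case: (HG x).
  have [_ NK] := HG MuPlus; have [_ NM] := HG MuMinus; have [_ NS] := HG Nu.
  by apply: near0_sub (near0_and NK (near0_and NM NS)) => z [? [? ?]]; case.
have [G0 HG0 E0] := sh _ _ H0; have [G1 HG1 E1] := sh _ _ H1.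
have [G2 HG2 E2] := sh _ _ H2; have [I2 HI2 E2'] := sh _ _ HG2.
have minor (f g f' g' : C -> C) c1 c2 c3 c4 (hf : hs f c1) (hg : hs g c2) (hf' : hs f' c3)
  (hg' : hs g' c4) := hs_sub (hs_mul hf hg) (hs_mul hf' hg').
have HD := hs_add (hs_sub
  (hs_mul (H0 MuPlus) (minor _ _ _ _ _ _ _ _ (HG1 MuMinus) (HI2 Nu) (HG1 Nu) (HI2 MuMinus)))
  (hs_mulX (hs_mul (HG1 MuPlus) (minor _ _ _ _ _ _ _ _ (HG0 MuMinus) (HI2 Nu) (HG0 Nu) (HI2 MuMinus)))))
  (hs_mulX (hs_mul (HI2 MuPlus) (minor _ _ _ _ _ _ _ _ (HG0 MuMinus) (HG1 Nu) (HG0 Nu) (HG1 MuMinus)))).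
have {}HD := hs_neq0 HD; rewrite /= !conv0 /shiftS v0K v1M v1S v2M v2S in HD.
have [|e e0 He] := near0_and (HD _) (near0_and (near0_and E0 E1) (near0_and E2 E2')).
  by rewrite (_ : _ + 0 = 3) ?pnatr_eq0//; ring.
exists e => // z /He[Dz [[{}E0 {}E1] [{}E2 {}E2']]] z0.
apply: contraNneq Dz => D0; apply/eqP; apply: (mulfI (expf_neq0 3 z0)).
rewrite mulr0 -D0 /det3 !E1 !E2 !E2' v10 v20 /shiftS v21 E0 v0K.
have EM := E0 MuMinus; have ES := E0 Nu; rewrite v0M v0S in EM ES.
by rewrite EM ES !v10 !v20 !v21; ring.
Qed.

End FundamentalSystem.

(** * Spaces of series solutions *)

Section FreeConstantsCriterion.
Variables (C : numClosedFieldType) (N : nat) (V : set (coefficients C)).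
Variables (b : 'I_N -> coefficients C) (p : 'I_N -> unknown * nat).

(** [b] is dual to the positions [p], so the coefficients at [p] are coordinates on V, and the
    vanishing of [b i] below its position makes the recursion triangular. Each leading coefficient
    is a nonzero linear form, whose kernel is an excluded hyperplane. *)
Lemma has_free_constants_echelon :
  (forall i j, b i (p j).1 (p j).2 = (i == j)%:R) ->
  (forall i x n, (n < (p i).2)%N -> b i x n = 0) ->
  (forall x, exists i, b i x 0%N != 0) ->
  V = [set lincomb c b | c in [set: 'I_N -> C]] ->
  has_free_constants N V.
Proof.
move=> bp tri lead VE.
have at_p c i : constant_at p (lincomb c b) i = c i.
  rewrite /constant_at /lincomb (bigD1 i) //= bp eqxx mulr1 big1 ?addr0// => j ji.
  by rewrite bp (negbTE ji) mulr0.
split.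
  exists b; split=> // c c0 i.
  by rewrite -[LHS]at_p /constant_at c0.
exists p; split.
- move=> c; exists (lincomb c b); split.
    by split; [rewrite VE; exists c|exact: at_p].
  move=> a []; rewrite VE => -[c' _ <-] H; congr lincomb; apply/funext => i.
  by rewrite -H at_p.
- move=> n a a'; rewrite VE => -[c _ <-] [c' _ <-] H x k kn; apply: eq_bigr => i _.
  have [pn|np] := leqP (p i).2 n; first by have := H i pn; rewrite !at_p => ->.
  by rewrite tri ?mulr0// (leq_ltn_trans kn).
(* One hyperplane per unknown; the default of [nth] serves as the third entry. *)
- pose X (i : 'I_3) := nth Nu [:: MuPlus; MuMinus] i.
  exists 3%N, (fun j i => b i (X j) 0%N); split; first by move=> j; exact: lead.
  move=> a; rewrite VE => -[c _ <-] H x.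
  have [j <-] : exists j, X j = x.
    by case: x; [exists ord0|exists (inord 1)|exists (inord 2)]; rewrite /X ?inordK.
  apply: contraNneq (H j) => E; apply/eqP; rewrite -[RHS]E; apply: eq_bigr => i _.
  by rewrite at_p mulrC.
Qed.

End FreeConstantsCriterion.

Section Padding.
Variable R : realType.
Local Notation C := (Cx R).
Implicit Types (c : nat -> C) (z : C).

(** Multiplication by z^k at the level of coefficients. *)
Definition pad k c n : C := if (n < k)%N then 0 else c (n - k)%N.

Lemma padD k c n : pad k c (n + k) = c n.
Proof. by rewrite /pad ltnNge leq_addl /= addnK. Qed.

Lemma psum_pad k c z n : psum (pad k c) z (n + k) = z ^+ k * psum c z n.
Proof.
elim: n => [|n IH]; last by rewrite addSn !psumS IH padD exprD; ring.
rewrite /psum big_ord0 mulr0 big1// => i _.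
by rewrite /pad ltn_ord mul0r.
Qed.

Lemma cvg_pad k c z s : z != 0 ->
  power_series (pad k c) z @ \oo --> z ^+ k * s <-> power_series c z @ \oo --> s.
Proof.
move=> z0; have zk : 0 < nm (z ^+ k) by rewrite nm_gt0 expf_neq0.
split=> /cvg_seqP H; apply/cvg_seqP => e e0.
  have [|n Hn] := H (nm (z ^+ k) * e); first by rewrite mulr_gt0.
  exists n => j nj; have := Hn (j + k)%N (leq_trans nj (leq_addr _ _)).
  by rewrite !power_seriesE psum_pad -mulrBr nmM ltr_pM2l.
have [|n Hn] := H (e / nm (z ^+ k)); first by rewrite divr_gt0.
exists (n + k)%N => j nj.
have kj : (k <= j)%N := leq_trans (leq_addl _ _) nj.
have := Hn (j - k)%N; rewrite leq_subRL// addnC => /(_ nj).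
rewrite !power_seriesE -{2}(subnK kj) psum_pad -mulrBr nmM.
by rewrite ltr_pdivlMr// mulrC.
Qed.

End Padding.

(** * Series solutions as combinations of three Frobenius series *)

Section SeriesSolutions.
Variable R : realType.
Local Notation C := (Cx R).
Implicit Types (z : C) (y : unknown -> C -> C).
Variables (q : C -> C) (t0 w rho : C) (r : C -> C).
Hypotheses (hq : painleve2_solution q) (ht0 : is_pole q t0).
Hypotheses (w0 : w != 0) (rho0 : 0 < rho) (hr : cbrt_branch w rho r).

(** [T] is [nat] for coefficient sequences and [C] for their sums. *)
Definition comb (T : Type) (v0 v1 v2 : unknown -> T -> C) (c0 c1 c2 : C) x (n : T) : C :=
  c0 * v0 x n + c1 * v1 x n + c2 * v2 x n.

Definition low_coefs (v : unknown -> nat -> C) (al2 c0 c1 c2 : C) :=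
  [/\ [/\ v MuPlus 0%N = c0, v MuMinus 0%N = 0 & v Nu 0%N = 0],
      [/\ v MuPlus 1%N = c1 / 3, v MuMinus 1%N = c1 & v Nu 1%N = - c1] &
      [/\ v MuPlus 2%N = (al2 * c0 - c2) / 3, v MuMinus 2%N = c2 & v Nu 2%N = 2 * c2]].

Definition local_domain (e : R) : set C := [set t0 + z | z in slit_disc w (inC e)].

Lemma fundamental_system : exists al2 v0 v1 v2 (F0 F1 F2 : unknown -> C -> C) (e : R),
  [/\ 0 < e /\ inC e <= rho,
    [/\ low_coefs v0 al2 1 0 0, low_coefs v1 al2 0 1 0 & low_coefs v2 al2 0 0 1],
    forall x, [/\ hs (F0 x) (v0 x), hs (F1 x) (v1 x) & hs (F2 x) (v2 x)],
    forall c0 c1 c2 (e' : R), e' <= e -> solves_system_on (local_domain e') q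
      (frac_solution t0 r (comb F0 F1 F2 c0 c1 c2)) &
    forall (e' : R) y, 0 < e' -> e' <= e -> solves_system_on (local_domain e') q y ->
      exists c0 c1 c2, forall x z, slit_disc w (inC e') z ->
        y x (t0 + z) = frac_solution t0 r (comb F0 F1 F2 c0 c1 c2) x (t0 + z)].
Proof.
have [al [be [de [a [b [d [[Hal Hbe Hde] [a0 a1] [b0 b1] [d0 d1 d2] L]]]]]]] :=
  pole_local_coefs hq ht0.
have frob := frobenius (hs_geo Hal) (hs_geo Hbe) (hs_geo Hde) a0 a1 b0 b1 d0 d1 d2.
have basis c0 c1 c2 : exists v (F : unknown -> C -> C),
    [/\ low_coefs v (a 2%N) c0 c1 c2, formal_solution a b d v & forall x, hs (F x) (v x)].
  have [v [fv gv l0 l1 l2]] := frob c0 c1 c2.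
  have [F HF] := choice (fun x => geo_hs (gv x)).
  by exists v, F.
have [v0 [F0 [l0 f0 H0]]] := basis 1 0 0.
have [v1 [F1 [l1 f1 H1]]] := basis 0 1 0.
have [v2 [F2 [l2 f2 H2]]] := basis 0 0 1.
have sound := formal_solution_sound t0 w0 rho0 hr Hal Hbe Hde.
have [e0 e00 S0] := sound _ _ f0 H0.
have [e1 e10 S1] := sound _ _ f1 H1.
have [e2 e20 S2] := sound _ _ f2 H2.
have [p p0 rhoE] := gt0_inC rho0.
have [e3 e30 D3] : near0 (fun z => z != 0 -> det3 (F0^~ z) (F1^~ z) (F2^~ z) != 0).
  have [[A1 A2 A3] _ _] := l0; have [[B1 B2 B3] [_ B5 B6] _] := l1.
  have [[G1 G2 G3] [G4 G5 G6] [_ G8 G9]] := l2.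
  apply: (det3_neq0 H0 H1 H2) => //; try by case.
  - by case; rewrite ?G4 ?G5 ?G6 ?mul0r ?oppr0.
  - by rewrite G9 mulr1.
have [e4 e40 L4] := L.
pose e := Num.min (Num.min e0 (Num.min e1 e2)) (Num.min p (Num.min e3 e4)).
have ee : [/\ e <= e0, e <= e1, e <= e2 & [/\ e <= p, e <= e3 & e <= e4]].
  by rewrite /e !ge_min !lexx !orbT.
have [ee0 ee1 ee2 [eep ee3 ee4]] := ee.
have eq (e' : R) : e' <= e -> forall y, solves_system_on (local_domain e') q y <->
    reduced_solution t0 w al be de e' y.
  move=> e'e y; apply: reduced_solutionP => z ze; apply: L4.
  by apply: lt_le_trans ze (le_trans e'e _).
exists (a 2%N), v0, v1, v2, F0, F1, F2, e; split=> //.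
- by rewrite !lt_min e00 e10 e20 p0 e30 e40 rhoE inC_le.
- move=> c0 c1 c2 e' e'e; apply/(eq _ e'e).
  have := reduced_solution_comb c0 c1 c2 (reduced_solution_sub (le_trans e'e ee0) S0)
    (reduced_solution_sub (le_trans e'e ee1) S1) (reduced_solution_sub (le_trans e'e ee2) S2).
  congr reduced_solution; apply/funext => x; apply/funext => t.
  by rewrite /frac_solution /comb; ring.
move=> e' y e'0 e'e /(eq _ e'e) Hy.
have [x [x0 sx _]] := exists_in_slit w0 e'0 ltr01.
set c := - (inC x * w) in sx.
have {}S0 := reduced_solution_sub (le_trans e'e ee0) S0.
have {}S1 := reduced_solution_sub (le_trans e'e ee1) S1.
have {}S2 := reduced_solution_sub (le_trans e'e ee2) S2.
set y0 := frac_solution t0 r F0 in S0; set y1 := frac_solution t0 r F1 in S1.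
set y2 := frac_solution t0 r F2 in S2.
pose D (Y0 Y1 Y2 : unknown -> C -> C) z : C := det3 (Y0^~ (t0 + z)) (Y1^~ (t0 + z)) (Y2^~ (t0 + z)).
(* Cramer quotients at one base point c. All four determinants are constant, so the same quotients
   work at every z. *)
exists (D y y1 y2 c / D y0 y1 y2 c), (D y0 y y2 c / D y0 y1 y2 c), (D y0 y1 y c / D y0 y1 y2 c).
move=> x' z sz; have z0 := slit_neq0 sz; have [ze _] := sz; rewrite norm_lt in ze.
have sp : slit_disc w rho z.
  by apply: slit_sub sz; rewrite rhoE inC_le (le_trans e'e).
have r0 := branch_neq0 hr sp.
have Dz : D y0 y1 y2 z != 0.
  have /(_ z0) : z != 0 -> det3 (F0^~ z) (F1^~ z) (F2^~ z) != 0.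
    by apply: D3; apply: lt_le_trans ze (le_trans e'e _).
  (* Each product in the determinant carries three factors [r z ^- 2] and one [z^-1]; the cofactor
     removes them. *)
  apply: contraNneq; rewrite /D /y0 /y1 /y2 /det3 !frac_solutionE => E.
  by apply/eqP; apply: (eq_of_multiple (l := r z ^+ 6 * z) E); field; rewrite r0 z0.
have cst Y0 Y1 Y2 (h0 : reduced_solution t0 w al be de e' Y0)
    (h1 : reduced_solution t0 w al be de e' Y1) (h2 : reduced_solution t0 w al be de e' Y2) :
    D Y0 Y1 Y2 c = D Y0 Y1 Y2 z := det3_const w0 h0 h1 h2 sx sz.
rewrite !cst//; apply: (mulfI Dz).
have := cramer3 (y0^~ (t0 + z)) (y1^~ (t0 + z)) (y2^~ (t0 + z)) (y^~ (t0 + z)) x'.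
rewrite -/(D y0 y1 y2 z) -/(D y y1 y2 z) -/(D y0 y y2 z) -/(D y0 y1 y z) /= => ->.
move: (D y y1 y2 z) (D y0 y y2 z) (D y0 y1 y z) (D y0 y1 y2 z) Dz => d00 d01 d02 dd dd0.
by rewrite /y0 /y1 /y2 !frac_solutionE /comb; field; rewrite r0 dd0.
Qed.

(** [j] marks nu, whose normalisation has an additional [z^-1], that is, 3 less in the exponent of
    r. *)
Lemma branch_powE (m : rat) (k : nat) (j : bool) z : slit_disc w rho z ->
  numq (3 * m) = (3 * k)%:Z - 2 - (if j then 3 else 0) ->
  branch_pow r m z = r z ^- 2 * z ^+ k * (if j then z^-1 else 1).
Proof.
move=> sz mk; have rn := branch_neq0 hr sz; have [_ rz] := hr sz.
rewrite /branch_pow mk !expfzDr// -exprnP exprM rz [X in X * _]mulrC.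
have r2 : r z ^ (- 2) = r z ^- 2 by [].
have r3 : r z ^ (- 3) = z^-1 by rewrite -[in RHS]rz.
by case: j {mk}; rewrite ?oppr0 r2 ?r3.
Qed.

Variables (al2 : C) (v0 v1 v2 : unknown -> nat -> C) (F0 F1 F2 : unknown -> C -> C) (e0 : R).
Hypotheses (e00 : 0 < e0) (e0rho : inC e0 <= rho).
Hypothesis HF : forall x, [/\ hs (F0 x) (v0 x), hs (F1 x) (v1 x) & hs (F2 x) (v2 x)].
Hypothesis sound : forall c0 c1 c2 (e' : R), e' <= e0 ->
  solves_system_on (local_domain e') q (frac_solution t0 r (comb F0 F1 F2 c0 c1 c2)).
Hypothesis complete : forall (e' : R) y, 0 < e' -> e' <= e0 -> solves_system_on (local_domain e') q y ->
  exists c0 c1 c2, forall x z, slit_disc w (inC e') z ->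
    y x (t0 + z) = frac_solution t0 r (comb F0 F1 F2 c0 c1 c2) x (t0 + z).

Lemma comb_hs c0 c1 c2 x : hs (comb F0 F1 F2 c0 c1 c2 x) (comb v0 v1 v2 c0 c1 c2 x).
Proof.
have [H0 H1 H2] := HF x.
exact: hs_add (hs_add (hs_scale c0 H0) (hs_scale c1 H1)) (hs_scale c2 H2).
Qed.

(* d x is the number of leading coefficients that the exponents m force to
   vanish in the normalisation z^(-2/3) (F MuPlus, F MuMinus, F Nu / z). *)
Variables (m : unknown -> rat) (d : unknown -> nat).
Hypothesis md : forall x,
  numq (3 * m x) = (3 * d x)%:Z - 2 - (if x is Nu then 3 else 0).

Lemma expansion_pad (e : C) (a : coefficients C) y : e <= rho ->
  has_expansion t0 w e r m a y <->
  forall x z, slit_disc w e z -> exists2 s : C,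
    power_series (pad (d x) (a x)) z @ \oo --> s &
    y x (t0 + z) = r z ^- 2 * s * (if x is Nu then z^-1 else 1).
Proof.
move=> er; have B x z : slit_disc w e z ->
    branch_pow r (m x) z = r z ^- 2 * z ^+ d x * (if x is Nu then z^-1 else 1).
  move=> /(slit_sub er) sz.
  by case: x (md x) => mx; [apply: (@branch_powE _ _ false)|apply: (@branch_powE _ _ false)|
    apply: (@branch_powE _ _ true)].
split=> H x z sz; have z0 := slit_neq0 sz; have [s Hs yE] := H x z sz.
  exists (z ^+ d x * s); first exact/cvg_pad.
  by rewrite yE B//; ring.
have [s' sE] : exists s' : C, s = z ^+ d x * s'.
  by exists (s / z ^+ d x); rewrite mulrCA divff ?mulr1// expf_neq0.
rewrite sE in Hs; exists s'; first by move: Hs => /(cvg_pad _ _ _ z0).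
by rewrite yE B// sE; ring.
Qed.

Lemma comb_expansion c0 c1 c2 (a : coefficients C) (e : R) y : 0 < e -> inC e <= rho ->
  (forall x, pad (d x) (a x) = comb v0 v1 v2 c0 c1 c2 x) ->
  (forall x z, slit_disc w (inC e) z ->
    y x (t0 + z) = frac_solution t0 r (comb F0 F1 F2 c0 c1 c2) x (t0 + z)) ->
  exists2 e' : R, 0 < e' <= e & has_expansion t0 w (inC e') r m a y.
Proof.
move=> e_gt0 erho aE yE.
have cv x := hs_cvg (comb_hs c0 c1 c2 x).
have [e1 e10 H1] := near0_and (cv MuPlus) (near0_and (cv MuMinus) (cv Nu)).
exists (Num.min e e1); first by rewrite lt_min e_gt0 e10 ge_min lexx.
have le1 : inC (Num.min e e1) <= inC e by rewrite inC_le ge_min lexx.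
apply/expansion_pad; first exact: le_trans erho.
move=> x z sz; have [ze _] := sz; rewrite norm_lt lt_min in ze.
have /andP[_ /H1[hK [hM hS]]] := ze.
exists (comb F0 F1 F2 c0 c1 c2 x z); first by rewrite aE; case: x.
by rewrite yE ?frac_solutionE//; apply: slit_sub sz.
Qed.

(** Convergence at one slit point gives the padded series a sum near 0. Completeness equates it with
    a combination on a slit disc, where the prefactor is nonzero, and points tending to 0 on the
    opposite ray determine all coefficients. *)
Lemma series_solutionsE : series_solutions q t0 w rho r m =
  [set a | exists c0 c1 c2, forall x, pad (d x) (a x) = comb v0 v1 v2 c0 c1 c2 x].
Proof.
apply/seteqP; split=> a /=; last first.
  move=> [c0 [c1 [c2 aE]]].
  have [e /andP[e_gt0 ee0] He] := @comb_expansion c0 c1 c2 a e0 _ e00 e0rho aE (fun _ _ _ => erefl).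
  exists (inC e), (frac_solution t0 r (comb F0 F1 F2 c0 c1 c2)); split=> //.
    by rewrite -{1}inC0 inC_lt e_gt0 /= (le_trans _ e0rho)// inC_le.
  exact: sound.
move=> [_ [y [/andP[/gt0_inC[e e_gt0 ->] erho] /(expansion_pad _ _ erho) He Hy]]].
pose e' := Num.min e e0.
have e'0 : 0 < e' by rewrite lt_min e_gt0.
have e'e : e' <= e by rewrite ge_min lexx.
have e'e0 : e' <= e0 by rewrite ge_min lexx orbT.
have sub z : slit_disc w (inC e') z -> slit_disc w (inC e) z.
  by apply: slit_sub; rewrite inC_le.
have [|c0 [c1 [c2 yE]]] := complete e'0 e'e0 (y := y).
  by move=> t [z /sub sz <-]; apply: Hy; exists z.
exists c0, c1, c2 => x.
have ga : geo (pad (d x) (a x)).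
  have [u [u0 su _]] := exists_in_slit w0 e_gt0 ltr01.
  by have [s Hs _] := He x _ su; apply: cvg_geo Hs; exact: slit_neq0 su.
have [P HP] := geo_hs ga; apply: (hs_coef_uniq HP (comb_hs c0 c1 c2 x)) => j j0.
have [e1 e10 H1] := hs_cvg HP.
have [|u [u0 su ue]] := exists_in_slit w0 e'0 (d := Num.min j e1); first by rewrite lt_min j0.
set z := - (inC u * w) in su ue; exists z.
have z0 := slit_neq0 su.
move: ue; rewrite lt_min => /andP[uj /H1 Pz]; split=> //.
have [s Hs E] := He x z (sub _ su); rewrite (cvg_unique_seq Pz Hs).
move: E; rewrite yE// frac_solutionE.
have rn : r z != 0 by apply: (branch_neq0 hr); apply: slit_sub (sub _ su).
have X0 : (if x is Nu then z^-1 else 1) != 0 by case: (x); rewrite ?oner_eq0 ?invr_eq0.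
by move=> /(mulIf X0) /mulfI ->; rewrite ?invr_eq0 ?expf_neq0.
Qed.

(** If the first [d x] coefficients of every combination vanish, dropping them writes any solution
    with the exponents m. *)
Lemma generic_typeP :
  (forall c0 c1 c2 x k, (k < d x)%N -> comb v0 v1 v2 c0 c1 c2 x k = 0) ->
  generic_type q t0 w rho r m.
Proof.
move=> van _ y /andP[/gt0_inC[e e_gt0 ->] erho] Hy.
pose e' := Num.min e e0.
have e'0 : 0 < e' by rewrite lt_min e_gt0.
have e'e : e' <= e by rewrite ge_min lexx.
have e'e0 : e' <= e0 by rewrite ge_min lexx orbT.
have sub z : slit_disc w (inC e') z -> slit_disc w (inC e) z.
  by apply: slit_sub; rewrite inC_le.
have [|c0 [c1 [c2 yE]]] := complete e'0 e'e0 (y := y).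
  by move=> t [z /sub sz <-]; apply: Hy; exists z.
have e'rho : inC e' <= rho by apply: le_trans erho; rewrite inC_le.
pose a x n := comb v0 v1 v2 c0 c1 c2 x (n + d x)%N.
have aE x : pad (d x) (a x) = comb v0 v1 v2 c0 c1 c2 x.
  apply/funext => n; rewrite /pad /a; case: ltnP => dn; first by rewrite van.
  by rewrite subnK.
have [e'' /andP[e''0 e''e'] He] := comb_expansion e'0 e'rho aE yE.
exists a, (inC e''); split=> //.
by rewrite -{1}inC0 inC_lt e''0 inC_le (le_trans e''e').
Qed.

End SeriesSolutions.

(** * The three types of series solutions *)

Theorem theorem2 (R : realType) (q : R[i] -> R[i]) (t0 : R[i])
    (w : R[i]) (rho : R[i]) (r : R[i] -> R[i])
    (hq : painleve2_solution q) (ht0 : is_pole q t0)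
    (hw : w != 0) (hrho : 0 < rho) (hr : cbrt_branch w rho r) :
  let solutions := series_solutions q t0 w rho r in
  [/\ has_free_constants 1 (solutions (exponents (4 / 3) (4 / 3) (1 / 3))),
      has_free_constants 2 (solutions (exponents (1 / 3) (1 / 3) (- (2 / 3)))),
      has_free_constants 3
        (solutions (exponents (- (2 / 3)) (1 / 3) (- (2 / 3)))) &
      generic_type q t0 w rho r (exponents (- (2 / 3)) (1 / 3) (- (2 / 3)))].
Proof.
move=> solutions.
have [al2 [v0 [v1 [v2 [F0 [F1 [F2 [e [[e0 erho] [l0 l1 l2] HF sound complete]]]]]]]]] :=
  @fundamental_system R q t0 w rho r hq ht0 hw hrho hr.
have [[A1 A2 A3] [A4 A5 A6] [A7 A8 A9]] := l0.
have [[B1 B2 B3] [B4 B5 B6] [B7 B8 B9]] := l1.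
have [[D1 D2 D3] [D4 D5 D6] [D7 D8 D9]] := l2.
have E m d md := @series_solutionsE R q t0 w rho r hw hr v0 v1 v2 F0 F1 F2 e
  e0 erho HF sound complete m d md.
have V2 x : v2 x 0%N = 0 /\ v2 x 1%N = 0.
  by case: x; rewrite ?D1 ?D2 ?D3 ?D4 ?D5 ?D6 ?mul0r ?oppr0.
have V1 x : v1 x 0%N = 0 by case: x.
(* Shifts relative to z^(-2/3), and to z^(-5/3) for nu. In the third type only mu_+ has shift 0, as
   the other two series have no constant term. *)
pose d1 (x : unknown) := 2%N; pose d2 (x : unknown) := 1%N.
pose d3 (x : unknown) := if x is MuPlus then 0%N else 1%N.
have m1 x : numq (3 * exponents (4 / 3) (4 / 3) (1 / 3) x) =
  (3 * d1 x)%:Z - 2 - (if x is Nu then 3 else 0) by case: x.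
have m2 x : numq (3 * exponents (1 / 3) (1 / 3) (- (2 / 3)) x) =
  (3 * d2 x)%:Z - 2 - (if x is Nu then 3 else 0) by case: x.
have m3 x : numq (3 * exponents (- (2 / 3)) (1 / 3) (- (2 / 3)) x) =
  (3 * d3 x)%:Z - 2 - (if x is Nu then 3 else 0) by case: x.
split.
(* The shift 2 forces c0 = c1 = 0, seen from the leading zeros for mu_+ and mu_-; the free constant
   is M_0. *)
- apply: (@has_free_constants_echelon (Cx R) 1 _ (fun _ x n => v2 x n.+2) (fun _ => (MuMinus, 0%N))).
  + by move=> i j; rewrite !ord1 /= D8.
  + by [].
  + by move=> x; exists ord0; case: x; rewrite ?D7 ?D8 ?D9 ?mulr0 ?sub0r ?mulr1 ?oner_eq0 ?mulNr ?oppr_eq0 ?mul1r ?invr_eq0.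
  rewrite /solutions (E _ _ m1); apply/seteqP; split=> a /=.
    move=> [c0 [c1 [c2 aE]]]; have := aE MuPlus; have := aE MuMinus.
    move=> /(congr1 (fun s => s 1%N)); rewrite /pad /comb /= A5 B5 D5 => c10.
    move=> /(congr1 (fun s => s 0%N)); rewrite /= A1 B1 D1 => c00.
    exists (fun _ => c2) => //; apply/funext => x; apply/funext => n.
    rewrite /lincomb big_ord1; have := congr1 (fun s => s (n + 2)%N) (aE x).
    rewrite padD /comb addn2 => ->.
    have -> : c0 = 0 by rewrite c00; ring.
    have -> : c1 = 0 by rewrite c10; ring.
    by ring.
  move=> [c _ <-]; exists 0, 0, (c ord0) => x; apply/funext => n.
  rewrite /pad /comb /lincomb !mul0r !add0r big_ord1.
  have [V20 V21] := V2 x.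
  by case: n => [|[|n]]; rewrite /= ?V20 ?V21 ?mulr0 ?subn2.
(* The shift 1 only forces c0 = 0; the free constants are M_0 and M_1, and [v1] alone has all three
   leading coefficients nonzero. *)
- apply: (@has_free_constants_echelon (Cx R) 2 _
    (fun i x n => if i == ord0 then v1 x n.+1 else v2 x n.+1) (fun i => (MuMinus, i : nat))).
  + by case=> [[|[|//]]] hi [[|[|//]]] hj; rewrite /= ?B5 ?B8 ?D5 ?D8.
  + by case=> [[|[|//]]] hi x [|n] //= _; case: (V2 x).
  + by move=> x; exists ord0; case: x; rewrite /= ?B4 ?B5 ?B6 ?oppr_eq0 ?mul1r ?invr_eq0 ?oner_eq0.
  rewrite /solutions (E _ _ m2); apply/seteqP; split=> a /=.
    move=> [c0 [c1 [c2 aE]]]; have := aE MuPlus.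
    move=> /(congr1 (fun s => s 0%N)); rewrite /pad /comb /= A1 B1 D1 => c00.
    exists (fun i => if i == ord0 then c1 else c2) => //; apply/funext => x; apply/funext => n.
    rewrite /lincomb !big_ord_recl big_ord0 /=.
    have := congr1 (fun s => s (n + 1)%N) (aE x).
    rewrite padD /comb addn1 => ->.
    have -> : c0 = 0 by rewrite c00; ring.
    by ring.
  move=> [c _ <-]; exists 0, (c ord0), (c (lift ord0 ord0)) => x; apply/funext => n.
  rewrite /pad /comb /lincomb !big_ord_recl big_ord0 /= mul0r add0r addr0.
  have [V20 _] := V2 x.
  by case: n => [|n]; rewrite /= ?V20 ?V1 ?mulr0 ?addr0 ?subn1.
(* The free constants are K_0, M_0 and M_1; K_0 is nonzero on [v0], while M_0 and S_0 are nonzero on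
   [v1]. *)
- apply: (@has_free_constants_echelon (Cx R) 3 _
    (fun i x n => nth v0 [:: v0; v1; v2] i x (n + d3 x)%N)
    (fun i => nth (MuPlus, 0%N) [:: (MuPlus, 0%N); (MuMinus, 0%N); (MuMinus, 1%N)] i)).
  + by case=> [[|[|[|//]]]] hi [[|[|[|//]]]] hj; rewrite /= ?A1 ?A5 ?A8 ?B1 ?B5 ?B8 ?D1 ?D5 ?D8.
  + case=> [[|[|[|//]]]] hi x [|n] //= _; have [V20 V21] := V2 x.
    by case: x V20 V21.
  + case; [exists ord0; rewrite /= A1|exists (lift ord0 ord0); rewrite /= B5|
      exists (lift ord0 ord0); rewrite /= B6]; by rewrite ?oppr_eq0 oner_eq0.
  rewrite /solutions (E _ _ m3); apply/seteqP; split=> a /=.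
    move=> [c0 [c1 [c2 aE]]].
    exists (fun i => nth 0 [:: c0; c1; c2] i) => //; apply/funext => x; apply/funext => n.
    rewrite /lincomb !big_ord_recl big_ord0 /=.
    have := congr1 (fun s => s (n + d3 x)%N) (aE x).
    by rewrite padD /comb => ->; ring.
  move=> [c _ <-]; exists (c ord0), (c (lift ord0 ord0)), (c (lift ord0 (lift ord0 ord0))) => x.
  apply/funext => n; rewrite /pad /comb /lincomb !big_ord_recl big_ord0 /= addr0.
  have [V20 _] := V2 x.
  by case: x V20; case: n => [|n] V20;
    rewrite /= ?subn0 ?addn0 ?A2 ?A3 ?V1 ?V20 ?mulr0 ?addr0 ?subn1 ?addn1 ?addrA.
- apply: (@generic_typeP R q t0 w rho r hr v0 v1 v2 F0 F1 F2 e e0 HF complete _ d3 m3).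
  move=> c0 c1 c2 x [|k]; rewrite /comb; case: x => //= _.
    by rewrite A2 B2 D2 !mulr0 !addr0.
  by rewrite A3 B3 D3 !mulr0 !addr0.
Qed.
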